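(* Let $M$ be a real constant and let $g$ be a complex-valued harmonic function in the unit disk $U$ with $g(0)=J_g(0)-1=0$ and $|g(z)|\le M$ for all $z\in U$. Put $$r_4=\frac{\lambda_0(M)}{\lambda_0(M)+2K(M)+\sqrt{\lambda_0(M)K(M)+4K(M)^2}},$$ and $$\sigma_4=\begin{cases}\lambda_0(M)\,r_4^3-K(M)\cdot\dfrac{r_4^4}{1-r_4}, & M>1,\\ 1, & M=1.\end{cases}$$ Then $F(z)=|z|^2g(z)$ is univalent in the disk $U_{r_4}$, and $F(U_{r_4})$ contains the schlicht disk $U_{\sigma_4}$. The result is sharp for $M=1$, i.e. for $M=1$ the radii $r_4=\sigma_4=1$ are best possible (neither can be replaced by a larger constant valid for all such $g$).
   Context: $U=\{z\in\mathbb{C}:|z|<1\}$ is the open unit disk and, for $r>0$, $U_r=\{z\in\mathbb{C}:|z|<r\}$. Univalent means injective. For a differentiable complex-valued function $f$, with $z=x+iy$, put $f_z=\frac12(f_x-if_y)$, $f_{\overline z}=\frac12(f_x+if_y)$; the Jacobian is $J_f(z)=|f_z(z)|^2-|f_{\overline z}(z)|^2$. Put $K(M)=\min\{\sqrt{2M^2-2},\ \frac{4M}{\pi}\}$, and, with $M_0=\frac{\pi}{2\sqrt[4]{2\pi^2-16}}\approx1.1296$, $$\lambda_0(M)=\begin{cases}\dfrac{\sqrt2}{\sqrt{M^2-1}+\sqrt{M^2+1}}, & 1\le M\le M_0,\\[2mm] \dfrac{\pi}{4M}, & M>M_0.\end{cases}$$ (The hypotheses force $M\ge1$.) *)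

(* Defs.v *)
(* Stdlib reals with Coquelicot. *)
From Stdlib Require Export Reals.
From Coquelicot Require Export Coquelicot.
Open Scope R_scope.

Definition disk (r : R) (z : C) : Prop := Cmod z < r.

Definition re_part (g : C -> C) (x y : R) : R := Re (g (x, y)).
Definition im_part (g : C -> C) (x y : R) : R := Im (g (x, y)).

(* [ex_diff_n u 2 x y] at every point of an open set [D] says that [u] is of
   class C^2 on [D]; [D] is only ever an open disk here. *)
Definition real_harmonic_on (D : C -> Prop) (u : R -> R -> R) : Prop :=
  forall x y : R, D (x, y) ->
    ex_diff_n u 2 x y /\
    partial_derive 2 0 u x y + partial_derive 0 2 u x y = 0.

Definition harmonic_on (D : C -> Prop) (g : C -> C) : Prop :=
  real_harmonic_on D (re_part g) /\ real_harmonic_on D (im_part g).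

Definition deriv_x (g : C -> C) (z : C) : C :=
  (partial_derive 1 0 (re_part g) (fst z) (snd z),
   partial_derive 1 0 (im_part g) (fst z) (snd z)).

Definition deriv_y (g : C -> C) (z : C) : C :=
  (partial_derive 0 1 (re_part g) (fst z) (snd z),
   partial_derive 0 1 (im_part g) (fst z) (snd z)).

Definition deriv_z (g : C -> C) (z : C) : C :=
  (RtoC (1 / 2) * (deriv_x g z - Ci * deriv_y g z))%C.

Definition deriv_zbar (g : C -> C) (z : C) : C :=
  (RtoC (1 / 2) * (deriv_x g z + Ci * deriv_y g z))%C.

Definition jacobian (g : C -> C) (z : C) : R :=
  (Cmod (deriv_z g z)) ^ 2 - (Cmod (deriv_zbar g z)) ^ 2.

Definition K (M : R) : R := Rmin (sqrt (2 * M ^ 2 - 2)) (4 * M / PI).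

Definition M0 : R := PI / (2 * sqrt (sqrt (2 * PI ^ 2 - 16))).

(* Only the values at [M >= 1] matter: the normalization at 0 together with
   the bound by [M] forces [M >= 1]. *)
Definition lambda0 (M : R) : R :=
  if Rle_dec M M0
  then sqrt 2 / (sqrt (M ^ 2 - 1) + sqrt (M ^ 2 + 1))
  else PI / (4 * M).

Definition r4 (M : R) : R :=
  lambda0 M /
  (lambda0 M + 2 * K M + sqrt (lambda0 M * K M + 4 * (K M) ^ 2)).

Definition sigma4 (M : R) : R :=
  if Rlt_dec 1 M
  then lambda0 M * (r4 M) ^ 3 - K M * ((r4 M) ^ 4 / (1 - r4 M))
  else 1.

Definition admissible (M : R) (g : C -> C) : Prop :=
  harmonic_on (disk 1) g /\
  g (RtoC 0) = RtoC 0 /\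
  jacobian g (RtoC 0) - 1 = 0 /\
  (forall z : C, disk 1 z -> Cmod (g z) <= M).

Definition F (g : C -> C) (z : C) : C := (RtoC ((Cmod z) ^ 2) * g z)%C.

(* [f] stands for a function whose domain is [D]; its values outside [D] are
   meaningless, so being univalent in [S] includes [S] lying inside [D]. *)
Definition univalent_in (D : C -> Prop) (f : C -> C) (S : C -> Prop) : Prop :=
  (forall z : C, S z -> D z) /\
  (forall z w : C, S z -> S w -> f z = f w -> z = w).

Definition image_contains (f : C -> C) (S T : C -> Prop) : Prop :=
  forall w : C, T w -> exists z : C, S z /\ f z = w.

(* Main.v *)
Require Import Defs.
From Stdlib Require Import Lra Lia.

(** Write [g] as the series of [a_n z^n + conj (b_n z^n)], [n >= 1]. Put
    [zeta = |z|^2 z], a bijection of the plane, and [L zeta = a_1 zeta + conj (b_1 zeta)].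
    Then [F z = L zeta + R], where [R] collects the terms
    [|z|^2 (a_n z^n + conj (b_n z^n))] with [n >= 2], and the whole argument takes
    place in the variable [zeta].

    The coefficients obey three constraints. The Jacobian at 0 gives
    [|a_1|^2 - |b_1|^2 = 1]. Bessel's inequality gives
    [|a_1|^2 + |b_1|^2 + |a_n|^2 + |b_n|^2 <= M^2]. Pairing [g] with
    [e^(-i n t)] and [e^(i n t)] at once gives [|a_n| + |b_n| <= 4 M / PI]
    ([heinz_bound]). Hence [|a_n| + |b_n| <= K M] for [n >= 2], and [L] does not
    shrink distances by more than the factor [lambda0 M], because its least
    stretching is [|a_1| - |b_1| = 1 / (|a_1| + |b_1|)].

    On [|z| <= r] the map [|z|^2 z^n] satisfies a Lipschitz condition with
    constant [n r^(n-1)] with respect to [zeta] ([cubed_power_lipschitz]). So [R]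
    has Lipschitz constant [K * sum_(n >= 2) n r^(n-1) = K ((1 - r)^(-2) - 1)]. This
    is less than [lambda0] for [r <= r4], [r < 1]: if [M > 1], the number [r4] solves
    [lambda0 = K * sum_(n >= 2) (n + 2) r^(n-1)], and if [M = 1], then [K = 0].
    Thus [F], as a function of [zeta], is a small Lipschitz perturbation of the
    invertible linear map [L]. Injectivity is immediate ([univalent_on_radius]), and [F z = w] is solved by the contraction
    principle applied to [zeta = L^(-1) (w - R)], as long as this maps the ball
    [|zeta| <= r^3] into itself, which is the case if [|w|] is less than
    [lambda0 r^3 - K r^4 / (1 - r)] ([covering_on_radius]). Sharpness for [M = 1]
    is seen on [g z = z].

    The expansion of [g] comes from Cauchy's formula for the gradients
    [u_x - i u_y] of its real and imaginary parts [u]: the average of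
    [f (z0 + s (w - z0)) w / (w - z0)] over the circle [|w| = rho] does not depend
    on [s] ([cauchy_average]). Throughout, a partial sum with an error
    [B q^N] takes the place of an infinite series. *)

(** * Continuity *)

Lemma continuous_Rplus (U : UniformSpace) (f g : U -> R) (x : U) :
  continuous f x -> continuous g x -> continuous (fun y => f y + g y) x.
Proof. intros; now apply (continuous_plus (V := R_NormedModule) f g x). Qed.

Lemma continuous_Rmult (U : UniformSpace) (f g : U -> R) (x : U) :
  continuous f x -> continuous g x -> continuous (fun y => f y * g y) x.
Proof. intros; now apply (continuous_mult (K := R_AbsRing) f g x). Qed.

Lemma continuous_Ropp (U : UniformSpace) (f : U -> R) (x : U) :
  continuous f x -> continuous (fun y => - f y) x.
Proof. intros; now apply (continuous_opp (V := R_NormedModule) f x). Qed.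

Lemma continuous_Rminus (U : UniformSpace) (f g : U -> R) (x : U) :
  continuous f x -> continuous g x -> continuous (fun y => f y - g y) x.
Proof. intros; now apply (continuous_minus (V := R_NormedModule) f g x). Qed.

Lemma continuous_cos_of (U : UniformSpace) (f : U -> R) (x : U) :
  continuous f x -> continuous (fun y => cos (f y)) x.
Proof. intro H; exact (continuous_comp f cos x H (continuous_cos (f x))). Qed.

Lemma continuous_sin_of (U : UniformSpace) (f : U -> R) (x : U) :
  continuous f x -> continuous (fun y => sin (f y)) x.
Proof. intro H; exact (continuous_comp f sin x H (continuous_sin (f x))). Qed.

Ltac cts :=
  repeat match goal with
  | |- continuous (fun _ => ?c) _ => apply continuous_const
  | |- continuous (fun x => x) _ => apply continuous_id
  | |- continuous (fun x => fst x) _ => apply continuous_fst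
  | |- continuous (fun x => snd x) _ => apply continuous_snd
  | |- continuous cos _ => apply continuous_cos
  | |- continuous sin _ => apply continuous_sin
  | |- continuous (Rmult ?c) _ => apply (continuous_Rmult _ (fun _ => c) (fun x => x))
  | |- continuous fst _ => apply continuous_fst
  | |- continuous snd _ => apply continuous_snd
  | |- continuous (fun x => _ + _) _ => apply continuous_Rplus
  | |- continuous (fun x => _ - _) _ => apply continuous_Rminus
  | |- continuous (fun x => _ * _) _ => apply continuous_Rmult
  | |- continuous (fun x => - _) _ => apply continuous_Ropp
  | |- continuous (fun x => cos (@?f x)) _ => apply (continuous_cos_of _ f)
  | |- continuous (fun x => sin (@?f x)) _ => apply (continuous_sin_of _ f)
  | H : forall t, continuous ?f t |- continuous ?f _ => apply H
  | H : forall t, continuous ?f t |- continuous (fun x => ?f x) _ => apply H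
  | H : forall t, continuous ?f t |- continuous (fun x => ?f (@?g x)) _ =>
      apply (continuous_comp g f)
  end.

(** * The holomorphic gradient of a harmonic function *)

(** The Cauchy-Riemann equations: [p + i q] has the continuous complex
    derivative [a + i b]. *)
Definition holomorphic_C1 (p q a b : R -> R -> R) : Prop :=
  forall x y : R, disk 1 (x, y) ->
    differentiable_pt_lim p x y (a x y) (- b x y) /\
    differentiable_pt_lim q x y (b x y) (a x y) /\
    continuity_2d_pt a x y /\ continuity_2d_pt b x y.

Lemma locally_2d_disk (P : R -> R -> Prop) (x y : R) :
  disk 1 (x, y) -> (forall u v, disk 1 (u, v) -> P u v) -> locally_2d P x y.
Proof.
  unfold disk; intros Hd HP.
  assert (He : 0 < (1 - Cmod (x, y)) / 2) by lra.
  exists (mkposreal _ He); simpl; intros u v Hu Hv.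
  apply HP.
  replace (u, v) with (Cplus (x, y) (u - x, v - y)) by (unfold Cplus; simpl; f_equal; ring).
  eapply Rle_lt_trans; [apply Cmod_triangle|].
  enough (Cmod (u - x, v - y) < 2 * ((1 - Cmod (x, y)) / 2)) by lra.
  set (e := (1 - Cmod (x, y)) / 2) in *.
  unfold Cmod; simpl fst; simpl snd.
  apply Rle_lt_trans with (Rabs (u - x) + Rabs (v - y)); [|lra].
  rewrite <- (sqrt_pow2 (Rabs (u - x) + Rabs (v - y))).
  - apply sqrt_le_1_alt.
    rewrite <- (pow2_abs (u - x)), <- (pow2_abs (v - y)).
    generalize (Rabs_pos (u - x)) (Rabs_pos (v - y)); intros; nra.
  - generalize (Rabs_pos (u - x)) (Rabs_pos (v - y)); lra.
Qed.

Lemma C1_differentiable (f fx : R -> R -> R) (fy x y : R) :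
  disk 1 (x, y) ->
  (forall u v, disk 1 (u, v) -> is_derive (fun t : R => f t v) u (fx u v)) ->
  is_derive (fun t : R => f x t) y fy -> continuity_2d_pt fx x y ->
  differentiable_pt_lim f x y (fx x y) fy.
Proof.
  intros Hd Hx Hy Hc.
  apply filterdiff_differentiable_pt_lim.
  apply (is_derive_filterdiff f x y fx fy); auto.
  - apply (proj1 (locally_2d_locally (fun a b => is_derive (fun t => f t b) a (fx a b)) x y)), locally_2d_disk; auto.
  - now apply continuity_2d_pt_filterlim in Hc.
Qed.

(** [u_x - i u_y] is holomorphic when [u] is harmonic: one Cauchy-Riemann
    equation is Laplace's, the other the symmetry of second derivatives. *)
Lemma harmonic_gradient (u : R -> R -> R) :
  real_harmonic_on (disk 1) u ->
  holomorphic_C1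
    (fun x y => Derive (fun t => u t y) x)
    (fun x y => - Derive (fun t => u x t) y)
    (fun x y => Derive (fun s => Derive (fun t => u t y) s) x)
    (fun x y => - Derive (fun s => Derive (fun t => u s t) y) x).
Proof.
  intros Hu x y Hd.
  assert (D : forall x y, disk 1 (x, y) ->
    (ex_derive (fun t => u t y) x /\ ex_derive (fun t => u x t) y) /\
    (ex_derive (fun s => Derive (fun t => u t y) s) x /\
     ex_derive (fun s => Derive (fun t => u t s) x) y /\
     continuity_2d_pt (fun x y => Derive (fun s => Derive (fun t => u t y) s) x) x y /\
     continuity_2d_pt (fun x y => Derive (fun s => Derive (fun t => u t s) x) y) x y) /\
    (ex_derive (fun s => Derive (fun t => u s t) y) x /\
     ex_derive (fun s => Derive (fun t => u x t) s) y /\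
     continuity_2d_pt (fun x y => Derive (fun s => Derive (fun t => u s t) y) x) x y /\
     continuity_2d_pt (fun x y => Derive (fun s => Derive (fun t => u x t) s) y) x y)).
  { clear x y Hd; intros x y Hd.
    destruct (Hu x y Hd) as [H _]; simpl in H; tauto. }
  assert (S : forall x y, disk 1 (x, y) ->
    Derive (fun s => Derive (fun t => u t s) x) y =
    Derive (fun s => Derive (fun t => u s t) y) x).
  { clear x y Hd; intros x y Hd. symmetry; apply Schwarz.
    - apply locally_2d_disk; auto. intros a b Hab; specialize (D a b Hab); tauto.
    - specialize (D x y Hd); tauto.
    - specialize (D x y Hd); tauto. }
  assert (L : forall x y, disk 1 (x, y) ->
    Derive (fun s => Derive (fun t => u x t) s) y =
    - Derive (fun s => Derive (fun t => u t y) s) x).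
  { clear x y Hd; intros x y Hd. destruct (Hu x y Hd) as [_ H].
    unfold partial_derive in H; simpl in H. lra. }
  pose proof (D x y Hd) as (_ & (D1 & D2 & D3 & D4) & (D5 & D6 & D7 & D8)).
  repeat split.
  - apply (C1_differentiable _ (fun x y => Derive (fun s => Derive (fun t => u t y) s) x)); auto.
    + intros s t Hst. apply Derive_correct.
      exact (proj1 (proj1 (proj2 (D s t Hst)))).
    + rewrite Ropp_involutive, <- S by auto. now apply Derive_correct.
  - apply (C1_differentiable _ (fun x y => - Derive (fun s => Derive (fun t => u s t) y) x)); auto.
    + intros s t Hst.
      apply (is_derive_opp (fun s => Derive (fun z => u s z) t)).
      apply Derive_correct. exact (proj1 (proj2 (proj2 (D s t Hst)))).
    + rewrite <- (Ropp_involutive (Derive _ x)), <- L by auto.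
      apply (is_derive_opp (fun s => Derive (fun z => u x z) s)).
      now apply Derive_correct.
    + apply continuity_2d_pt_opp; auto.
  - exact D3.
  - apply continuity_2d_pt_opp; auto.
Qed.

(** * Cauchy's formula on shrinking circles *)

Lemma Cmod_pair_le (x y r : R) : 0 <= r -> x ^ 2 + y ^ 2 <= r ^ 2 -> Cmod (x, y) <= r.
Proof.
  intros Hr H. unfold Cmod; simpl fst; simpl snd.
  rewrite <- (sqrt_pow2 r) by auto. now apply sqrt_le_1_alt.
Qed.

(** Since [rho (1 + (1 - rho)) < 1], the margin [(1 - rho) / 2] beyond either end
    of [0, 1] does not leave the disk; it allows differentiation at both ends. *)
Lemma shrinking_circle_in_disk (x0 y0 rho s t : R) :
  Cmod (x0, y0) < rho -> rho < 1 ->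
  - ((1 - rho) / 2) < s < 1 + (1 - rho) / 2 ->
  disk 1 (x0 + s * (rho * cos t - x0), y0 + s * (rho * sin t - y0)).
Proof.
  intros H0 H1 Hs. unfold disk.
  replace (x0 + s * (rho * cos t - x0), y0 + s * (rho * sin t - y0))
    with (Cplus (Cmult (RtoC (1 - s)) (x0, y0)) (Cmult (RtoC s) (rho * cos t, rho * sin t)))
    by (unfold Cplus, Cmult, RtoC; simpl; f_equal; ring).
  eapply Rle_lt_trans; [apply Cmod_triangle|].
  rewrite !Cmod_mult, !Cmod_R.
  pose proof (Cmod_ge_0 (x0, y0)).
  assert (Cmod (rho * cos t, rho * sin t) <= rho).
  { apply Cmod_pair_le; [lra|].
    generalize (sin2_cos2 t); unfold Rsqr; intros E. nra. }
  assert (Rabs (1 - s) * Cmod (x0, y0) <= Rabs (1 - s) * rho)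
    by (apply Rmult_le_compat_l; [apply Rabs_pos|lra]).
  assert (Rabs s * Cmod (rho * cos t, rho * sin t) <= Rabs s * rho)
    by (apply Rmult_le_compat_l; [apply Rabs_pos|lra]).
  assert (Rabs (1 - s) + Rabs s <= 1 + (1 - rho)).
  { unfold Rabs; destruct (Rcase_abs (1 - s)), (Rcase_abs s); lra. }
  assert ((Rabs (1 - s) + Rabs s) * rho <= (1 + (1 - rho)) * rho)
    by (apply Rmult_le_compat_r; lra).
  nra.
Qed.

Lemma is_derive_lincomb (f g : R -> R) (x l m c d : R) :
  is_derive f x l -> is_derive g x m ->
  is_derive (fun t => f t * c - g t * d) x (l * c - m * d).
Proof.
  intros Hf Hg. auto_derive.
  - repeat split; eexists; eassumption.
  - apply is_derive_unique in Hf. apply is_derive_unique in Hg.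
    change (fun x => f x) with f. change (fun x => g x) with g.
    rewrite Hf, Hg. ring.
Qed.

(** Differentiating [f (z0 + s (w - z0))] in [s] produces the factor [w - z0],
    which the kernel [k = k1 + i k2] turns into [m = m1 + i m2]. This is the real
    part of the statement; the kernel [- i k] gives the imaginary part. *)
Lemma shrinking_circle_derive (p q a b : R -> R -> R) (k1 k2 m1 m2 : R -> R) (x0 y0 rho s : R) :
  holomorphic_C1 p q a b ->
  (forall t, continuous k1 t) -> (forall t, continuous k2 t) ->
  (forall t, continuous m1 t) -> (forall t, continuous m2 t) ->
  Cmod (x0, y0) < rho -> rho < 1 ->
  (forall t, (rho * cos t - x0) * k1 t - (rho * sin t - y0) * k2 t = m1 t) ->
  (forall t, (rho * sin t - y0) * k1 t + (rho * cos t - x0) * k2 t = m2 t) ->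
  0 <= s <= 1 ->
  is_derive (fun s => RInt (fun t =>
      p (x0 + s * (rho * cos t - x0)) (y0 + s * (rho * sin t - y0)) * k1 t -
      q (x0 + s * (rho * cos t - x0)) (y0 + s * (rho * sin t - y0)) * k2 t) 0 (2 * PI)) s
    (RInt (fun t =>
      a (x0 + s * (rho * cos t - x0)) (y0 + s * (rho * sin t - y0)) * m1 t -
      b (x0 + s * (rho * cos t - x0)) (y0 + s * (rho * sin t - y0)) * m2 t) 0 (2 * PI)).
Proof.
  intros Hf Ck1 Ck2 Cm1 Cm2 H0 H1 E1 E2 Hs.
  pose proof (Cmod_ge_0 (x0, y0)) as Hpos.
  set (X := fun s t => x0 + s * (rho * cos t - x0)).
  set (Y := fun s t => y0 + s * (rho * sin t - y0)).
  assert (He : 0 < (1 - rho) / 2) by lra.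
  pose (near := fun s => - ((1 - rho) / 2) < s < 1 + (1 - rho) / 2).
  assert (In : forall s t, near s -> disk 1 (X s t, Y s t))
    by (intros; now apply shrinking_circle_in_disk).
  assert (Loc : forall s, 0 <= s <= 1 -> locally s near).
  { intros s' Hs'. exists (mkposreal _ He). intros s'' Hb.
    apply Rabs_lt_between' in Hb. unfold near; simpl in Hb; lra. }
  assert (Der : forall s t, near s ->
    is_derive (fun s => p (X s t) (Y s t) * k1 t - q (X s t) (Y s t) * k2 t) s
      (a (X s t) (Y s t) * m1 t - b (X s t) (Y s t) * m2 t)).
  { intros s' t Hs'. destruct (Hf _ _ (In s' t Hs')) as (P & Q & _ & _).
    replace (a (X s' t) (Y s' t) * m1 t - b (X s' t) (Y s' t) * m2 t) with
      ((a (X s' t) (Y s' t) * (rho * cos t - x0) + - b (X s' t) (Y s' t) * (rho * sin t - y0)) * k1 t -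
       (b (X s' t) (Y s' t) * (rho * cos t - x0) + a (X s' t) (Y s' t) * (rho * sin t - y0)) * k2 t)
      by (rewrite <- E1, <- E2; ring).
    assert (DX : derivable_pt_lim (fun s => X s t) s' (rho * cos t - x0)).
    { apply is_derive_Reals. unfold X. auto_derive; [trivial|ring]. }
    assert (DY : derivable_pt_lim (fun s => Y s t) s' (rho * sin t - y0)).
    { apply is_derive_Reals. unfold Y. auto_derive; [trivial|ring]. }
    apply (is_derive_lincomb (fun s => p (X s t) (Y s t)) (fun s => q (X s t) (Y s t)));
      apply is_derive_Reals.
    - exact (derivable_pt_lim_comp_2d p (fun s => X s t) (fun s => Y s t) s' _ _ _ _ P DX DY).
    - exact (derivable_pt_lim_comp_2d q (fun s => X s t) (fun s => Y s t) s' _ _ _ _ Q DX DY). }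
  change (is_derive (fun s => RInt (fun t =>
      p (X s t) (Y s t) * k1 t - q (X s t) (Y s t) * k2 t) 0 (2 * PI)) s
    (RInt (fun t => a (X s t) (Y s t) * m1 t - b (X s t) (Y s t) * m2 t) 0 (2 * PI))).
  assert (Ns : near s) by (unfold near; lra).
  rewrite (RInt_ext (fun t => a (X s t) (Y s t) * m1 t - b (X s t) (Y s t) * m2 t)
     (fun t => Derive (fun u => p (X u t) (Y u t) * k1 t - q (X u t) (Y u t) * k2 t) s))
    by (intros t _; symmetry; apply is_derive_unique, Der, Ns).
  apply (is_derive_RInt_param (fun s t => p (X s t) (Y s t) * k1 t - q (X s t) (Y s t) * k2 t)).
  - eapply filter_imp; [|apply Loc, Hs]. intros s' Hs' t _. eexists; now apply Der.
  - intros t _.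
    apply (continuity_2d_pt_ext_loc
      (fun s t => a (X s t) (Y s t) * m1 t - b (X s t) (Y s t) * m2 t)).
    { destruct (Loc s Hs) as [e Hl]. exists e. intros u v Hu _.
      symmetry; apply is_derive_unique, Der, Hl. exact Hu. }
    apply continuity_2d_pt_filterlim.
    destruct (Hf _ _ (In s t Ns)) as (_ & _ & A & B).
    apply continuity_2d_pt_filterlim in A. apply continuity_2d_pt_filterlim in B.
    change (continuous (fun z : R * R => a (X (fst z) (snd z)) (Y (fst z) (snd z)) * m1 (snd z) - b (X (fst z) (snd z)) (Y (fst z) (snd z)) * m2 (snd z)) (s, t)).
    assert (CX : continuous (fun z : R * R => X (fst z) (snd z)) (s, t)) by (unfold X; cts).
    assert (CY : continuous (fun z : R * R => Y (fst z) (snd z)) (s, t)) by (unfold Y; cts).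
    apply continuous_Rminus; apply continuous_Rmult.
    + now apply (continuous_comp_2 (fun z : R * R => X (fst z) (snd z)) (fun z : R * R => Y (fst z) (snd z)) a).
    + cts.
    + now apply (continuous_comp_2 (fun z : R * R => X (fst z) (snd z)) (fun z : R * R => Y (fst z) (snd z)) b).
    + cts.
  - eapply filter_imp; [|apply Loc, Hs]. intros s' Hs'.
    apply (ex_RInt_continuous (V := R_CompleteNormedModule)). intros t _.
    destruct (Hf _ _ (In s' t Hs')) as (P & Q & _ & _).
    assert (P' : continuity_2d_pt p (X s' t) (Y s' t))
      by (apply differentiable_continuity_pt; eexists; eexists; exact P).
    assert (Q' : continuity_2d_pt q (X s' t) (Y s' t))
      by (apply differentiable_continuity_pt; eexists; eexists; exact Q).
    apply continuity_2d_pt_filterlim in P'. apply continuity_2d_pt_filterlim in Q'.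
    assert (CX : continuous (fun t => X s' t) t) by (unfold X; cts).
    assert (CY : continuous (fun t => Y s' t) t) by (unfold Y; cts).
    apply continuous_Rminus; apply continuous_Rmult; auto.
    + now apply (continuous_comp_2 (fun t => X s' t) (fun t => Y s' t) p).
    + now apply (continuous_comp_2 (fun t => X s' t) (fun t => Y s' t) q).
Qed.

(** Comparing [s = 1], the circle of radius [rho] about 0, with [s = 0], where
    the circle has collapsed to the point [z0]. *)
Lemma shrinking_circle_const (p q a b : R -> R -> R) (k1 k2 m1 m2 : R -> R) (x0 y0 rho : R) :
  holomorphic_C1 p q a b ->
  (forall t, continuous k1 t) -> (forall t, continuous k2 t) ->
  (forall t, continuous m1 t) -> (forall t, continuous m2 t) ->
  Cmod (x0, y0) < rho -> rho < 1 ->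
  (forall t, (rho * cos t - x0) * k1 t - (rho * sin t - y0) * k2 t = m1 t) ->
  (forall t, (rho * sin t - y0) * k1 t + (rho * cos t - x0) * k2 t = m2 t) ->
  (forall s, 0 < s < 1 -> RInt (fun t =>
      a (x0 + s * (rho * cos t - x0)) (y0 + s * (rho * sin t - y0)) * m1 t -
      b (x0 + s * (rho * cos t - x0)) (y0 + s * (rho * sin t - y0)) * m2 t) 0 (2 * PI) = 0) ->
  RInt (fun t => p (rho * cos t) (rho * sin t) * k1 t - q (rho * cos t) (rho * sin t) * k2 t) 0 (2 * PI) =
  p x0 y0 * RInt k1 0 (2 * PI) - q x0 y0 * RInt k2 0 (2 * PI).
Proof.
  intros Hf Ck1 Ck2 Cm1 Cm2 H0 H1 E1 E2 HZ.
  pose (I := fun s => RInt (fun t =>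
      p (x0 + s * (rho * cos t - x0)) (y0 + s * (rho * sin t - y0)) * k1 t -
      q (x0 + s * (rho * cos t - x0)) (y0 + s * (rho * sin t - y0)) * k2 t) 0 (2 * PI)).
  destruct (MVT_cor2 I (fun s => RInt (fun t =>
      a (x0 + s * (rho * cos t - x0)) (y0 + s * (rho * sin t - y0)) * m1 t -
      b (x0 + s * (rho * cos t - x0)) (y0 + s * (rho * sin t - y0)) * m2 t) 0 (2 * PI)) 0 1)
    as (c & Hc & Hc01); [lra| |].
  - intros c Hc. apply is_derive_Reals. now apply shrinking_circle_derive.
  - rewrite HZ in Hc by auto.
    transitivity (I 1).
    { apply RInt_ext; intros t _.
      now replace (x0 + 1 * (rho * cos t - x0)) with (rho * cos t) by ring;
        replace (y0 + 1 * (rho * sin t - y0)) with (rho * sin t) by ring. }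
    replace (I 1) with (I 0) by lra.
    unfold I.
    rewrite (RInt_ext _ (fun t => minus (scal (p x0 y0) (k1 t)) (scal (q x0 y0) (k2 t)))).
    + assert (X1 : ex_RInt k1 0 (2 * PI))
        by (apply (ex_RInt_continuous (V := R_CompleteNormedModule)); auto).
      assert (X2 : ex_RInt k2 0 (2 * PI))
        by (apply (ex_RInt_continuous (V := R_CompleteNormedModule)); auto).
      rewrite (RInt_minus (V := R_CompleteNormedModule)).
      2, 3: now apply (ex_RInt_scal (V := R_NormedModule)).
      now rewrite !(RInt_scal (V := R_CompleteNormedModule)) by auto.
    + intros t _. rewrite !Rmult_0_l, !Rplus_0_r. reflexivity.
Qed.

Lemma RInt_derive_loop (G dG : R -> R) :
  (forall t, is_derive G t (dG t)) -> (forall t, continuous dG t) -> G (2 * PI) = G 0 ->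
  RInt dG 0 (2 * PI) = 0.
Proof.
  intros HD HC HP. apply is_RInt_unique.
  evar_last; [apply (is_RInt_derive (V := R_CompleteNormedModule) G dG); auto|].
  rewrite HP. apply (minus_eq_zero (G := R_AbelianGroup)).
Qed.

(** Cauchy's theorem for the derivative [a + i b] of [f]: along the circle of
    parameter [s], the product of [a + i b] with [i s w] is the [t]-derivative of
    the periodic function [f]. *)
Lemma circle_integral_derivative (p q a b : R -> R -> R) (x0 y0 rho s : R) :
  holomorphic_C1 p q a b -> Cmod (x0, y0) < rho -> rho < 1 -> 0 < s < 1 ->
  RInt (fun t =>
      a (x0 + s * (rho * cos t - x0)) (y0 + s * (rho * sin t - y0)) * (rho * cos t) -
      b (x0 + s * (rho * cos t - x0)) (y0 + s * (rho * sin t - y0)) * (rho * sin t)) 0 (2 * PI) = 0 /\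
  RInt (fun t =>
      a (x0 + s * (rho * cos t - x0)) (y0 + s * (rho * sin t - y0)) * (rho * sin t) -
      b (x0 + s * (rho * cos t - x0)) (y0 + s * (rho * sin t - y0)) * (- (rho * cos t))) 0 (2 * PI) = 0.
Proof.
  intros Hf H0 H1 Hs.
  set (X := fun t => x0 + s * (rho * cos t - x0)).
  set (Y := fun t => y0 + s * (rho * sin t - y0)).
  assert (In : forall t, disk 1 (X t, Y t))
    by (intros; apply shrinking_circle_in_disk; lra).
  assert (DX : forall t, derivable_pt_lim X t (- s * (rho * sin t))).
  { intro t. apply is_derive_Reals. unfold X. auto_derive; [trivial|ring]. }
  assert (DY : forall t, derivable_pt_lim Y t (s * (rho * cos t))).
  { intro t. apply is_derive_Reals. unfold Y. auto_derive; [trivial|ring]. }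
  assert (CX : forall t, continuous X t) by (intros; unfold X; cts).
  assert (CY : forall t, continuous Y t) by (intros; unfold Y; cts).
  assert (CA : forall t, continuous (fun t => a (X t) (Y t)) t).
  { intro t. apply (continuous_comp_2 X Y a); auto.
    apply continuity_2d_pt_filterlim, (Hf _ _ (In t)). }
  assert (CB : forall t, continuous (fun t => b (X t) (Y t)) t).
  { intro t. apply (continuous_comp_2 X Y b); auto.
    apply continuity_2d_pt_filterlim, (Hf _ _ (In t)). }
  assert (X2 : X (2 * PI) = X 0) by (unfold X; now rewrite cos_2PI, cos_0).
  assert (Y2 : Y (2 * PI) = Y 0) by (unfold Y; now rewrite sin_2PI, sin_0).
  split.
  - apply (RInt_derive_loop (fun t => / s * q (X t) (Y t))).
    + intro t. destruct (Hf _ _ (In t)) as (_ & Q & _ & _).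
      pose proof (derivable_pt_lim_comp_2d q X Y t _ _ _ _ Q (DX t) (DY t)) as HH.
      apply is_derive_Reals in HH.
      evar_last; [apply (is_derive_scal _ _ (/ s) _ HH)|].
      fold (X t) (Y t). field. lra.
    + intro t. cts.
    + now rewrite X2, Y2.
  - apply (RInt_derive_loop (fun t => - / s * p (X t) (Y t))).
    + intro t. destruct (Hf _ _ (In t)) as (P & _ & _ & _).
      pose proof (derivable_pt_lim_comp_2d p X Y t _ _ _ _ P (DX t) (DY t)) as HH.
      apply is_derive_Reals in HH.
      evar_last; [apply (is_derive_scal _ _ (- / s) _ HH)|].
      fold (X t) (Y t). field. lra.
    + intro t. cts.
    + now rewrite X2, Y2.
Qed.

(** * Averages over a circle *)

Definition ccontinuous (phi : R -> C) : Prop :=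
  forall t, continuous (fun t => Re (phi t)) t /\ continuous (fun t => Im (phi t)) t.

Definition average (phi : R -> C) : C :=
  (/ (2 * PI) * RInt (fun t => Re (phi t)) 0 (2 * PI),
   / (2 * PI) * RInt (fun t => Im (phi t)) 0 (2 * PI)).

Definition cis (t : R) : C := (cos t, sin t).

Lemma ccontinuous_const (c : C) : ccontinuous (fun _ => c).
Proof. split; apply continuous_const. Qed.

Lemma ccontinuous_plus (f g : R -> C) :
  ccontinuous f -> ccontinuous g -> ccontinuous (fun t => f t + g t)%C.
Proof.
  intros Hf Hg t; destruct (Hf t), (Hg t).
  split; unfold Cplus; simpl; now apply continuous_Rplus.
Qed.

Lemma ccontinuous_mult (f g : R -> C) :
  ccontinuous f -> ccontinuous g -> ccontinuous (fun t => f t * g t)%C.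
Proof.
  intros Hf Hg t; destruct (Hf t), (Hg t).
  split; unfold Cmult; simpl.
  - now apply continuous_Rminus; apply continuous_Rmult.
  - now apply continuous_Rplus; apply continuous_Rmult.
Qed.

Lemma ccontinuous_opp (f : R -> C) :
  ccontinuous f -> ccontinuous (fun t => - f t)%C.
Proof. intros Hf t; destruct (Hf t). split; unfold Copp; simpl; now apply continuous_Ropp. Qed.

Lemma ccontinuous_conj (f : R -> C) :
  ccontinuous f -> ccontinuous (fun t => Cconj (f t)).
Proof. intros Hf t; destruct (Hf t). split; unfold Cconj; simpl; auto; now apply continuous_Ropp. Qed.

Lemma ccontinuous_pow (f : R -> C) (n : nat) :
  ccontinuous f -> ccontinuous (fun t => f t ^ n)%C.
Proof.
  intro Hf; induction n as [|n IH]; simpl; [apply ccontinuous_const|].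
  now apply ccontinuous_mult.
Qed.

Lemma ccontinuous_cis (c : R) : ccontinuous (fun t => cis (c * t)).
Proof. intro t; split; unfold cis, Re, Im; simpl; cts. Qed.

Lemma ccontinuous_ext (f g : R -> C) :
  (forall t, f t = g t) -> ccontinuous f -> ccontinuous g.
Proof.
  intros E Hf t; destruct (Hf t). split.
  - apply (continuous_ext (fun t => Re (f t))); auto; intro; now rewrite E.
  - apply (continuous_ext (fun t => Im (f t))); auto; intro; now rewrite E.
Qed.

Lemma ccontinuous_inv (f : R -> C) :
  (forall t, f t <> 0) -> ccontinuous f -> ccontinuous (fun t => / f t)%C.
Proof.
  intros N Hf t; destruct (Hf t).
  assert (0 < Re (f t) ^ 2 + Im (f t) ^ 2).
  { rewrite <- Cmod2_alt. apply pow_lt, Cmod_gt_0, N. }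
  split; unfold Cinv; simpl; unfold Rdiv; cts; auto;
    apply (continuous_comp _ Rinv).
  1, 3: simpl; unfold Re, Im in *; cts; auto.
  all: apply (continuous_Rinv (_ : R)); unfold Re, Im in *; simpl in *; lra.
Qed.

Lemma ex_RInt_cont (f : R -> R) (a b : R) : (forall t, continuous f t) -> ex_RInt f a b.
Proof. intros; apply (ex_RInt_continuous (V := R_CompleteNormedModule)); auto. Qed.

Lemma average_ext (f g : R -> C) : (forall t, f t = g t) -> average f = average g.
Proof.
  intro E; unfold average; f_equal; f_equal; apply RInt_ext; intros; now rewrite E.
Qed.

Lemma average_plus (f g : R -> C) : ccontinuous f -> ccontinuous g ->
  average (fun t => f t + g t)%C = (average f + average g)%C.
Proof.
  intros Hf Hg. unfold average, Cplus; simpl.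
  f_equal; rewrite <- Rmult_plus_distr_l; f_equal.
  - apply (RInt_plus (V := R_CompleteNormedModule) (fun t => Re (f t)) (fun t => Re (g t)));
      apply ex_RInt_cont; [exact (fun t => proj1 (Hf t)) | exact (fun t => proj1 (Hg t))].
  - apply (RInt_plus (V := R_CompleteNormedModule) (fun t => Im (f t)) (fun t => Im (g t)));
      apply ex_RInt_cont; [exact (fun t => proj2 (Hf t)) | exact (fun t => proj2 (Hg t))].
Qed.

Lemma average_scal (c : C) (f : R -> C) : ccontinuous f ->
  average (fun t => c * f t)%C = (c * average f)%C.
Proof.
  intros Hf.
  assert (X1 : ex_RInt (fun t => Re (f t)) 0 (2 * PI)) by (apply ex_RInt_cont; apply Hf).
  assert (X2 : ex_RInt (fun t => Im (f t)) 0 (2 * PI)) by (apply ex_RInt_cont; apply Hf).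
  unfold average, Cmult; simpl. f_equal.
  - rewrite (RInt_ext _ (fun t => minus (scal (fst c) (Re (f t))) (scal (snd c) (Im (f t))))).
    2: reflexivity.
    rewrite (RInt_minus (V := R_CompleteNormedModule)).
    2, 3: now apply (ex_RInt_scal (V := R_NormedModule)).
    rewrite !(RInt_scal (V := R_CompleteNormedModule)) by auto.
    unfold minus, plus, opp, scal; simpl; unfold mult; simpl; ring.
  - rewrite (RInt_ext _ (fun t => plus (scal (fst c) (Im (f t))) (scal (snd c) (Re (f t))))).
    2: reflexivity.
    rewrite (RInt_plus (V := R_CompleteNormedModule)).
    2, 3: now apply (ex_RInt_scal (V := R_NormedModule)).
    rewrite !(RInt_scal (V := R_CompleteNormedModule)) by auto.
    unfold minus, plus, opp, scal; simpl; unfold mult; simpl; ring.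
Qed.

Lemma average_const (c : C) : average (fun _ => c) = c.
Proof.
  unfold average. rewrite !RInt_const. unfold scal; simpl; unfold mult; simpl.
  pose proof PI_RGT_0. destruct c; simpl; f_equal; field; lra.
Qed.

Lemma Re_average_le (f : R -> C) (psi : R -> R) : ccontinuous f -> (forall t, continuous psi t) ->
  (forall t, 0 <= t <= 2 * PI -> Re (f t) <= psi t) -> Re (average f) <= / (2 * PI) * RInt psi 0 (2 * PI).
Proof.
  intros Hf Hp H. pose proof PI_RGT_0. unfold average; simpl.
  apply Rmult_le_compat_l; [left; apply Rinv_0_lt_compat; lra|].
  apply RInt_le; [lra| | |].
  - apply ex_RInt_cont. exact (fun t => proj1 (Hf t)).
  - now apply ex_RInt_cont.
  - intros t Ht. apply H; lra.
Qed.

Lemma Re_le_Cmod (z : C) : Re z <= Cmod z.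
Proof. eapply Rle_trans; [apply Rle_abs|apply re_le_Cmod]. Qed.

Lemma exists_rotation (z : C) : exists u : C, Cmod u = 1 /\ (u * z)%C = RtoC (Cmod z).
Proof.
  destruct (Ceq_dec z 0) as [->|N].
  - exists 1. rewrite Cmod_1, Cmod_0. split; [trivial|ring].
  - exists (Cconj z / RtoC (Cmod z))%C.
    assert (0 < Cmod z) by now apply Cmod_gt_0.
    assert (RtoC (Cmod z) <> 0) by (intro Q; apply RtoC_inj in Q; lra).
    split.
    + rewrite Cmod_div, Cmod_conj, Cmod_R, Rabs_pos_eq by (auto; lra). field; lra.
    + transitivity (z * Cconj z / RtoC (Cmod z))%C; [field; auto|].
      rewrite <- Cmod2_conj, RtoC_pow. field; auto.
Qed.

Lemma average_bound (f : R -> C) (B : R) : ccontinuous f ->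
  (forall t, 0 <= t <= 2 * PI -> Cmod (f t) <= B) -> Cmod (average f) <= B.
Proof.
  intros Hf HB. destruct (exists_rotation (average f)) as (u & Hu & E).
  apply (f_equal Re) in E. change (Re (RtoC ?x)) with x in E. rewrite <- E.
  rewrite <- average_scal by auto.
  eapply Rle_trans; [apply (Re_average_le _ (fun _ => B))|].
  - apply ccontinuous_mult; auto using ccontinuous_const.
  - intro; apply continuous_const.
  - intros t Ht. eapply Rle_trans; [apply Re_le_Cmod|]. rewrite Cmod_mult, Hu, Rmult_1_l. auto.
  - rewrite RInt_const. unfold scal; simpl; unfold mult; simpl.
    pose proof PI_RGT_0. right; field; lra.
Qed.

(** The Cauchy integral formula, before its kernel [k = w / (w - z0)] is
    integrated: [f] may be replaced by its value at [z0]. *)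
Lemma cauchy_average (p q a b : R -> R -> R) (k : R -> C) (z0 : C) (rho : R) :
  holomorphic_C1 p q a b -> Cmod z0 < rho -> rho < 1 -> ccontinuous k ->
  (forall t, (rho * cis t - z0) * k t = rho * cis t)%C ->
  average (fun t => Cmult (p (rho * cos t) (rho * sin t), q (rho * cos t) (rho * sin t)) (k t)) =
  Cmult (p (fst z0) (snd z0), q (fst z0) (snd z0)) (average k).
Proof.
  intros Hf H0 H1 Ck Ek. destruct z0 as [x0 y0]; simpl fst; simpl snd.
  assert (C1 : forall t, continuous (fun t => Re (k t)) t) by apply Ck.
  assert (C2 : forall t, continuous (fun t => Im (k t)) t) by apply Ck.
  assert (E1 : forall t, (rho * cos t - x0) * Re (k t) - (rho * sin t - y0) * Im (k t) = rho * cos t).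
  { intro t. generalize (f_equal Re (Ek t)). unfold cis, Re, Im; simpl. lra. }
  assert (E2 : forall t, (rho * sin t - y0) * Re (k t) + (rho * cos t - x0) * Im (k t) = rho * sin t).
  { intro t. generalize (f_equal Im (Ek t)). unfold cis, Re, Im; simpl. lra. }
  unfold average, Cmult, Re, Im in *; simpl in *. f_equal.
  - rewrite (shrinking_circle_const p q a b _ _ (fun t => rho * cos t) (fun t => rho * sin t) x0 y0); auto.
    + ring.
    + intro; cts.
    + intro; cts.
    + intros s Hs. exact (proj1 (circle_integral_derivative p q a b x0 y0 rho s Hf H0 H1 Hs)).
  - rewrite (RInt_ext (fun t => p (rho * cos t) (rho * sin t) * snd (k t) + q (rho * cos t) (rho * sin t) * fst (k t)) (fun t => p (rho * cos t) (rho * sin t) * snd (k t) - q (rho * cos t) (rho * sin t) * (- fst (k t)))) by (intros; simpl; ring).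
    rewrite (shrinking_circle_const p q a b _ (fun t => - fst (k t)) (fun t => rho * sin t) (fun t => - (rho * cos t)) x0 y0); auto.
    + rewrite (RInt_opp (V := R_CompleteNormedModule) (fun t => fst (k t))) by (apply ex_RInt_cont; auto).
      unfold opp; simpl; ring.
    + intro; cts; auto.
    + intro; cts.
    + intro; cts.
    + intro t; generalize (E2 t); lra.
    + intro t; generalize (E1 t); lra.
    + intros s Hs. exact (proj2 (circle_integral_derivative p q a b x0 y0 rho s Hf H0 H1 Hs)).
Qed.

(** * Expansions with an explicit remainder *)

Lemma le_of_geometric (x C q : R) : 0 <= q < 1 -> (forall N : nat, x <= C * q ^ N) -> x <= 0.
Proof.
  intros Hq H.
  apply (is_lim_seq_le (fun _ => x) (fun N => C * q ^ N) x 0); auto.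
  - apply is_lim_seq_const.
  - replace (Finite 0) with (Rbar_mult (Finite C) (Finite 0)) by (simpl; f_equal; ring).
    apply is_lim_seq_scal_l, is_lim_seq_geom. rewrite Rabs_pos_eq; lra.
Qed.

Lemma Cminus_eq_0 (x y : C) : (x - y)%C = 0 -> x = y.
Proof. intro E. transitivity (x - y + y)%C; [ring|]. rewrite E. ring. Qed.

Lemma eq_of_geometric (x y : C) (B q : R) :
  0 <= q < 1 -> (forall N : nat, Cmod (x - y) <= B * q ^ N) -> x = y.
Proof.
  intros Hq H. apply le_of_geometric in H; auto.
  apply Cminus_eq_0, Cmod_eq_0. generalize (Cmod_ge_0 (x - y)); lra.
Qed.

Lemma Cconj_R (x : R) : Cconj x = x.
Proof. unfold Cconj, RtoC; simpl; f_equal; ring. Qed.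

Lemma csum_S (a : nat -> C) (N : nat) : sum_n a (S N) = (sum_n a N + a (S N))%C.
Proof. exact (sum_Sn a N). Qed.

Lemma csum_O (a : nat -> C) : sum_n a 0 = a 0%nat.
Proof. exact (sum_O a). Qed.

Lemma cis_plus (s t : R) : cis (s + t) = (cis s * cis t)%C.
Proof. unfold cis, Cmult; simpl; f_equal; [apply cos_plus | rewrite sin_plus; ring]. Qed.

Lemma cis_opp (t : R) : cis (- t) = Cconj (cis t).
Proof. unfold cis, Cconj; simpl; f_equal; [apply cos_neg | apply sin_neg]. Qed.

Lemma cis_0 : cis 0 = 1.
Proof. unfold cis; now rewrite cos_0, sin_0. Qed.

Lemma Cmod_cis (t : R) : Cmod (cis t) = 1.
Proof.
  unfold Cmod, cis; simpl fst; simpl snd. rewrite <- sqrt_1. f_equal.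
  generalize (sin2_cos2 t); unfold Rsqr; lra.
Qed.

Lemma cis_pow (t : R) (n : nat) : (cis t ^ n)%C = cis (INR n * t).
Proof.
  induction n as [|n IH].
  - simpl. now rewrite Rmult_0_l, cis_0.
  - rewrite Cpow_S, IH, S_INR, <- cis_plus. f_equal; ring.
Qed.

Lemma average_cis (k : Z) : k <> 0%Z -> average (fun t => cis (IZR k * t)) = 0.
Proof.
  intro Hk. assert (K : IZR k <> 0) by now apply not_0_IZR.
  assert (P : sin (IZR k * (2 * PI)) = 0).
  { apply sin_eq_0_1. exists (2 * k)%Z. rewrite mult_IZR. ring. }
  assert (Q : cos (IZR k * (2 * PI)) = 1).
  { replace (IZR k * (2 * PI)) with (2 * (IZR k * PI)) by ring.
    rewrite cos_2a_sin. rewrite (sin_eq_0_1 (IZR k * PI)) by (now exists k). ring. }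
  unfold average, cis; simpl.
  rewrite (RInt_derive_loop (fun t => / IZR k * sin (IZR k * t))).
  2: { intro t. auto_derive; auto. field; auto. }
  2: { intro t; cts. }
  2: { rewrite P, !Rmult_0_r, sin_0; ring. }
  rewrite (RInt_derive_loop (fun t => - / IZR k * cos (IZR k * t))).
  2: { intro t. auto_derive; auto. field; auto. }
  2: { intro t; cts. }
  2: { rewrite Q, !Rmult_0_r, cos_0; ring. }
  now rewrite !Rmult_0_r.
Qed.

Lemma bounded_on_circle (f : R -> C) : ccontinuous f ->
  exists B, 0 <= B /\ forall t, 0 <= t <= 2 * PI -> Cmod (f t) <= B.
Proof.
  intros Hf. pose proof PI_RGT_0.
  destruct (continuity_ab_maj (fun t => Rabs (Re (f t)) + Rabs (Im (f t))) 0 (2 * PI)) as (m & Hm & _); [lra| |].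
  - intros t _. apply continuity_pt_filterlim.
    apply (continuous_Rplus _ (fun t => Rabs (Re (f t))) (fun t => Rabs (Im (f t))));
      apply continuous_Rabs_comp; [exact (proj1 (Hf t)) | exact (proj2 (Hf t))].
  - eexists; split; [|intros t Ht; eapply Rle_trans; [|exact (Hm t Ht)]].
    + generalize (Rabs_pos (Re (f m))) (Rabs_pos (Im (f m))); lra.
    + unfold Re, Im. destruct (f t) as [x y]; simpl. apply Cmod_pair_le.
      * generalize (Rabs_pos x) (Rabs_pos y); lra.
      * rewrite <- (pow2_abs x), <- (pow2_abs y).
        generalize (Rabs_pos x) (Rabs_pos y); intros; nra.
Qed.

Lemma circle_nz (rho t : R) : 0 < rho -> (rho * cis t)%C <> 0.
Proof.
  intros H. apply Cmod_gt_0. rewrite Cmod_mult, Cmod_cis, Cmod_R, Rabs_pos_eq; lra.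
Qed.

Lemma circle_minus_nz (rho t : R) (z : C) : Cmod z < rho -> (rho * cis t - z)%C <> 0.
Proof.
  intros H E. assert (rho * cis t = z)%C as <-.
  { now apply Cminus_eq_0. }
  rewrite Cmod_mult, Cmod_cis, Cmod_R in H. generalize (Rle_abs rho); lra.
Qed.

Lemma ccontinuous_circle (rho : R) : ccontinuous (fun t => rho * cis t)%C.
Proof.
  apply ccontinuous_mult; [apply ccontinuous_const|].
  apply (ccontinuous_ext (fun t => cis (1 * t))); [intro; now rewrite Rmult_1_l|].
  apply ccontinuous_cis.
Qed.

Lemma ccontinuous_kernel (rho : R) (z : C) : Cmod z < rho ->
  ccontinuous (fun t => rho * cis t / (rho * cis t - z))%C.
Proof.
  intro H. apply ccontinuous_mult; [apply ccontinuous_circle|].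
  apply ccontinuous_inv; [intro; now apply circle_minus_nz|].
  apply ccontinuous_plus; [apply ccontinuous_circle|apply ccontinuous_const].
Qed.

Lemma Cmod_kernel (rho t : R) (z : C) : Cmod z < rho ->
  Cmod (rho * cis t / (rho * cis t - z)) <= rho / (rho - Cmod z).
Proof.
  intro H. pose proof (Cmod_ge_0 z).
  rewrite Cmod_div by now apply circle_minus_nz.
  assert (E : Cmod (rho * cis t) = rho) by (rewrite Cmod_mult, Cmod_cis, Cmod_R, Rabs_pos_eq; lra).
  rewrite E. apply Rmult_le_compat_l; [lra|]. apply Rinv_le_contravar; [lra|].
  assert (rho <= Cmod (rho * cis t - z) + Cmod z); [|lra].
  rewrite <- E at 1. replace (Cmult rho (cis t)) with (Cplus (Cminus (Cmult rho (cis t)) z) z) at 1 by ring.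
  apply Cmod_triangle.
Qed.

(** Expanding [w / (w - z)] into a geometric series under the average; the
    remainder is explicit, so that no limit is exchanged with an integral. *)
Lemma kernel_expansion (phi : R -> C) (B rho : R) (z : C) (N : nat) :
  ccontinuous phi -> (forall t, 0 <= t <= 2 * PI -> Cmod (phi t) <= B) -> Cmod z < rho ->
  Cmod (average (fun t => phi t * (rho * cis t / (rho * cis t - z)))%C -
        sum_n (fun n => average (fun t => phi t * (/ (rho * cis t)) ^ n) * z ^ n)%C N)
  <= B * (rho / (rho - Cmod z)) * (Cmod z / rho) ^ S N.
Proof.
  intros Hphi HB Hz. pose proof (Cmod_ge_0 z) as Z0.
  assert (R0 : 0 < rho) by lra.
  set (k := fun t => (rho * cis t / (rho * cis t - z))%C).
  assert (Ck : ccontinuous k) by now apply ccontinuous_kernel.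
  assert (Ci : forall n, ccontinuous (fun t => (/ (rho * cis t)) ^ n)%C).
  { intro n. apply ccontinuous_pow, ccontinuous_inv; [intro; now apply circle_nz|].
    apply ccontinuous_circle. }
  assert (D : average (fun t => phi t * k t)%C =
    (sum_n (fun n => average (fun t => phi t * (/ (rho * cis t)) ^ n) * z ^ n)%C N +
     z ^ S N * average (fun t => phi t * ((/ (rho * cis t)) ^ S N * k t)))%C).
  { assert (St : forall n,
      average (fun t => phi t * ((/ (rho * cis t)) ^ n * k t))%C =
      (average (fun t => phi t * (/ (rho * cis t)) ^ n) +
       z * average (fun t => phi t * ((/ (rho * cis t)) ^ S n * k t)))%C).
    { intro n. rewrite <- average_scal, <- average_plus.
      - apply average_ext; intro t. rewrite Cpow_S.
        set (x := (/ (rho * cis t))%C). set (y := (x ^ n)%C).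
        assert (k t = 1 + z * x * k t)%C as Hk.
        { generalize (circle_nz rho t R0) (circle_minus_nz rho t z Hz). unfold k, x.
          generalize (rho * cis t)%C; intros w W1 W2. field; auto. }
        rewrite Hk at 1. ring.
      - now apply ccontinuous_mult.
      - apply ccontinuous_mult; [apply ccontinuous_const|].
        apply ccontinuous_mult; auto. now apply ccontinuous_mult.
      - apply ccontinuous_mult; auto. now apply ccontinuous_mult. }
    induction N as [|N IH].
    - rewrite csum_O.
      transitivity (average (fun t => phi t * ((/ (rho * cis t)) ^ 0 * k t)))%C.
      + apply average_ext; intro; rewrite (Cmult_1_l (k _) : (_ ^ 0 * _ = _)%C); reflexivity.
      + rewrite St. simpl. ring.
    - rewrite csum_S, IH, St, !Cpow_S. ring. }
  change (average (fun t => phi t * (rho * cis t / (rho * cis t - z)))%C)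
    with (average (fun t => phi t * k t)%C).
  rewrite D.
  replace (sum_n _ N + _ - sum_n _ N)%C with
    (z ^ S N * average (fun t => phi t * ((/ (rho * cis t)) ^ S N * k t)))%C by ring.
  rewrite Cmod_mult, Cmod_pow.
  replace (B * (rho / (rho - Cmod z)) * (Cmod z / rho) ^ S N) with
    (Cmod z ^ S N * (B * ((/ rho) ^ S N * (rho / (rho - Cmod z)))))
    by (unfold Rdiv; rewrite Rpow_mult_distr; ring).
  apply Rmult_le_compat_l; [now apply pow_le|].
  apply average_bound.
  - apply ccontinuous_mult; auto. now apply ccontinuous_mult.
  - intros t Ht. rewrite !Cmod_mult, Cmod_pow, Cmod_inv by now apply circle_nz.
    rewrite (Cmod_mult rho), Cmod_cis, Cmod_R, Rmult_1_r, (Rabs_pos_eq rho) by lra.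
    assert (0 <= (/ rho) ^ S N) by (apply pow_le; left; now apply Rinv_0_lt_compat).
    apply Rmult_le_compat; auto using Cmod_ge_0.
    + apply Rmult_le_pos; auto using Cmod_ge_0.
    + apply Rmult_le_compat_l; auto. now apply Cmod_kernel.
Qed.

(** Only the constant term of the geometric series has a nonzero average. *)
Lemma average_kernel (rho : R) (z : C) : Cmod z < rho ->
  average (fun t => rho * cis t / (rho * cis t - z))%C = 1.
Proof.
  intro H. pose proof (Cmod_ge_0 z).
  apply (eq_of_geometric _ _ (rho / (rho - Cmod z) * (Cmod z / rho)) (Cmod z / rho)).
  - split; [apply Rle_mult_inv_pos; lra|]. apply (Rmult_lt_reg_r rho); [lra|].
    unfold Rdiv. rewrite Rmult_assoc, Rinv_l; lra.
  - intro N.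
    replace (rho / (rho - Cmod z) * (Cmod z / rho) * (Cmod z / rho) ^ N) with
      (1 * (rho / (rho - Cmod z)) * (Cmod z / rho) ^ S N) by (simpl; ring).
    eapply Rle_trans; [|apply (kernel_expansion (fun _ => RtoC 1) 1 rho z N); auto].
    + right. f_equal. f_equal; [apply average_ext; intro; ring|]. f_equal.
      clear -H H0. induction N as [|N IH].
      * rewrite csum_O. simpl. rewrite (average_ext _ (fun _ => RtoC 1)), average_const; [ring|intro; ring].
      * rewrite csum_S, <- IH.
        assert (E : average (fun t => 1 * (/ (rho * cis t)) ^ S N)%C = 0).
        { rewrite (average_ext _ (fun t => (/ rho) ^ S N * cis (IZR (- Z.of_nat (S N)) * t))%C).
          - rewrite average_scal by apply ccontinuous_cis.
            rewrite average_cis by lia. ring.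
          - intro t. rewrite opp_IZR, <- INR_IZR_INZ, Ropp_mult_distr_l_reverse, Ropp_mult_distr_r.
            rewrite <- cis_pow, cis_opp, Cmult_1_l, <- Cpow_mult_l. f_equal.
            assert (N1 : cis t <> 0) by (apply Cmod_gt_0; rewrite Cmod_cis; lra).
            assert (N2 : RtoC rho <> 0) by (intro Q; apply RtoC_inj in Q; lra).
            assert (Q : (cis t * Cconj (cis t) = 1)%C) by (rewrite <- Cmod2_conj, Cmod_cis; now rewrite pow1).
            apply (f_equal (fun x => / rho * / cis t * x)%C) in Q.
            transitivity (/ rho * / cis t * 1)%C; [field; auto|]. rewrite <- Q. field; auto. }
        rewrite E. ring.
    + apply ccontinuous_const.
    + intros; rewrite Cmod_1; lra.
Qed.

(** Cauchy's formula followed by the geometric series for its kernel. *)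
Lemma holomorphic_expansion (p q a b : R -> R -> R) (rho : R) :
  holomorphic_C1 p q a b -> 0 < rho < 1 ->
  exists (A : nat -> C) (B : R), 0 <= B /\ forall (z : C) (N : nat), Cmod z < rho ->
    Cmod ((p (fst z) (snd z), q (fst z) (snd z)) - sum_n (fun n => A n * z ^ n)%C N)
    <= B * (rho / (rho - Cmod z)) * (Cmod z / rho) ^ S N.
Proof.
  intros Hf Hr.
  pose (phi := fun t => (p (rho * cos t) (rho * sin t), q (rho * cos t) (rho * sin t)) : C).
  assert (Cphi : ccontinuous phi).
  { assert (Hd : forall t, disk 1 (rho * cos t, rho * sin t)).
    { intro t. unfold disk. apply Rle_lt_trans with rho; [|lra].
      apply Cmod_pair_le; [lra|]. generalize (sin2_cos2 t); unfold Rsqr; intro; nra. }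
    intro t. destruct (Hf _ _ (Hd t)) as (P & Q & _ & _).
    assert (P' : continuity_2d_pt p (rho * cos t) (rho * sin t))
      by (apply differentiable_continuity_pt; eexists; eexists; exact P).
    assert (Q' : continuity_2d_pt q (rho * cos t) (rho * sin t))
      by (apply differentiable_continuity_pt; eexists; eexists; exact Q).
    apply continuity_2d_pt_filterlim in P'. apply continuity_2d_pt_filterlim in Q'.
    unfold phi, Re, Im; simpl. split.
    - apply (continuous_comp_2 (fun t => rho * cos t) (fun t => rho * sin t) p); auto; cts.
    - apply (continuous_comp_2 (fun t => rho * cos t) (fun t => rho * sin t) q); auto; cts. }
  destruct (bounded_on_circle phi Cphi) as (B & B0 & HB).
  exists (fun n => average (fun t => phi t * (/ (rho * cis t)) ^ n)%C), B.
  split; auto. intros z N Hz.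
  eapply Rle_trans; [right|apply (kernel_expansion phi B rho z N); auto].
  do 2 f_equal.
  rewrite <- (Cmult_1_r (_, _)), <- (average_kernel rho z Hz).
  symmetry. apply (cauchy_average p q a b); auto; try lra.
  - now apply ccontinuous_kernel.
  - intro t. generalize (circle_minus_nz rho t z Hz).
    generalize (rho * cis t)%C; intros w W. field; auto.
Qed.

Lemma Re_mult_R (c : C) (x : R) : Re (c * x) = Re c * x.
Proof. unfold Re, Cmult; simpl; ring. Qed.

Lemma is_derive_ray_polynomial (A : nat -> C) (z : C) (N : nat) (s : R) :
  is_derive (fun s : R => Re (sum_n (fun n => A n * RtoC (/ INR (S n)) * (s * z) ^ S n)%C N)) s
    (Re (z * sum_n (fun n => A n * (s * z) ^ n)%C N)).
Proof.
  assert (T : forall n, is_derive (fun s : R => Re (A n * RtoC (/ INR (S n)) * (s * z) ^ S n)) s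
    (Re (z * (A n * (s * z) ^ n)))).
  { intro n. assert (Hn : INR (S n) <> 0) by (apply not_0_INR; lia).
    apply (is_derive_ext (fun s : R => Re (A n * z ^ S n) * (/ INR (S n) * s ^ S n))).
    - intro v. rewrite Cpow_mult_l, <- RtoC_pow.
      replace (A n * RtoC (/ INR (S n)) * (RtoC (v ^ S n) * z ^ S n))%C
        with (A n * z ^ S n * RtoC (/ INR (S n) * v ^ S n))%C by (rewrite RtoC_mult; ring).
      now rewrite Re_mult_R.
    - rewrite Cpow_mult_l, <- RtoC_pow.
      replace (z * (A n * (RtoC (s ^ n) * z ^ n)))%C with (A n * z ^ S n * RtoC (s ^ n))%C
        by (rewrite Cpow_S; ring).
      rewrite Re_mult_R. generalize (Re (A n * z ^ S n)) (Rinv_l _ Hn). generalize (/ INR (S n)); intros c d Hc.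
      auto_derive; [trivial|].
      change (match n with 0%nat => 1 | S _ => INR n + 1 end) with (INR (S n)).
      change (Init.Nat.pred (S n)) with n. transitivity (d * ((c * INR (S n)) * s ^ n)); [ring|rewrite Hc; ring]. }
  induction N as [|N IH].
  - apply (is_derive_ext (fun s : R => Re (A 0%nat * RtoC (/ INR 1) * (s * z) ^ 1))).
    + intro; now rewrite csum_O.
    + rewrite csum_O. apply T.
  - apply (is_derive_ext (fun s : R =>
      Re (sum_n (fun n => A n * RtoC (/ INR (S n)) * (s * z) ^ S n)%C N) +
      Re (A (S N) * RtoC (/ INR (S (S N))) * (s * z) ^ S (S N)))).
    + intro; now rewrite csum_S.
    + rewrite csum_S. rewrite Cmult_plus_distr_l.
      exact (is_derive_plus _ _ _ _ _ IH (T (S N))).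
Qed.

(** Integrating the expansion of [u_x - i u_y] along the ray from 0 to [z];
    the mean value theorem carries the remainder over. *)
Lemma harmonic_expansion (u : R -> R -> R) (rho : R) :
  real_harmonic_on (disk 1) u -> 0 < rho < 1 ->
  exists (alpha : nat -> C) (B : R), 0 <= B /\
    alpha 0%nat = (partial_derive 1 0 u 0 0, - partial_derive 0 1 u 0 0) /\
    forall (z : C) (N : nat), Cmod z < rho ->
      Rabs (u (fst z) (snd z) - u 0 0 - Re (sum_n (fun n => alpha n * z ^ S n)%C N))
      <= B * (rho / (rho - Cmod z)) * (Cmod z / rho) ^ S N.
Proof.
  intros Hu Hr. pose proof (harmonic_gradient u Hu) as Hf.
  destruct (holomorphic_expansion _ _ _ _ rho Hf Hr) as (A & B & B0 & HA).
  set (p := fun x y => Derive (fun t => u t y) x) in HA.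
  set (q := fun x y => - Derive (fun t => u x t) y) in HA.
  exists (fun n => A n * RtoC (/ INR (S n)))%C, B. split; [auto|split].
  - change (INR 1) with 1. rewrite Rinv_1, Cmult_1_r.
    assert (E : ((p 0 0, q 0 0) : C) = A 0%nat).
    { specialize (HA 0 0%nat). rewrite Cmod_0, csum_O in HA.
      specialize (HA (proj1 Hr)).
      replace (B * (rho / (rho - 0)) * (0 / rho) ^ 1) with 0 in HA by (field; lra).
      apply Cminus_eq_0, Cmod_eq_0. apply Rle_antisym; [|apply Cmod_ge_0].
      change (0 ^ 0)%C with (RtoC 1) in HA. rewrite Cmult_1_r in HA. exact HA. }
    rewrite <- E. reflexivity.
  - intros z N Hz. pose proof (Cmod_ge_0 z) as Z0.
    pose (G := fun s : R => u (s * fst z) (s * snd z) -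
      Re (sum_n (fun n => A n * RtoC (/ INR (S n)) * (s * z) ^ S n)%C N)).
    assert (Sc : forall s : R, (s * z)%C = (s * fst z, s * snd z)).
    { intro s. destruct z. unfold Cmult, RtoC; simpl; f_equal; ring. }
    assert (Cm : forall s : R, 0 <= s <= 1 -> Cmod (s * z) <= Cmod z).
    { intros s Hs. rewrite Cmod_mult, Cmod_R, Rabs_pos_eq by lra. nra. }
    destruct (MVT_cor2 G (fun s : R =>
       Re (z * ((p (s * fst z) (s * snd z), q (s * fst z) (s * snd z)) -
                sum_n (fun n => A n * (s * z) ^ n)%C N))) 0 1) as (c & Hc & Hc01); [lra| |].
    + intros s Hs. apply is_derive_Reals.
      assert (Hd : disk 1 (s * fst z, s * snd z)).
      { unfold disk. rewrite <- Sc. specialize (Cm s Hs); lra. }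
      match goal with |- is_derive _ _ (Re (z * (?X - ?Y))%C) =>
        replace (Re (z * (X - Y))%C) with (Re (z * X)%C - Re (z * Y)%C)
          by (unfold Re, Cmult, Cminus, Copp, Cplus; simpl; ring) end.
      apply (is_derive_minus (K := R_AbsRing) (V := R_NormedModule) (fun s => u (s * fst z) (s * snd z))
        (fun s : R => Re (sum_n (fun n => A n * RtoC (/ INR (S n)) * (s * z) ^ S n)%C N)));
        [|apply is_derive_ray_polynomial].
      assert (Du : differentiable_pt_lim u (s * fst z) (s * snd z)
        (p (s * fst z) (s * snd z)) (- q (s * fst z) (s * snd z))).
      { apply (C1_differentiable u p); auto.
        - intros v w Hvw. apply Derive_correct. exact (proj1 (proj2 (proj1 (Hu v w Hvw)))).
        - unfold q. rewrite Ropp_involutive. apply Derive_correct.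
          exact (proj1 (proj2 (proj2 (proj1 (Hu _ _ Hd))))).
        - apply differentiable_continuity_pt. eexists; eexists. exact (proj1 (Hf _ _ Hd)). }
      assert (D1 : derivable_pt_lim (fun s => s * fst z) s (fst z))
        by (apply is_derive_Reals; auto_derive; [trivial|ring]).
      assert (D2 : derivable_pt_lim (fun s => s * snd z) s (snd z))
        by (apply is_derive_Reals; auto_derive; [trivial|ring]).
      pose proof (derivable_pt_lim_comp_2d u (fun s => s * fst z) (fun s => s * snd z) s _ _ _ _ Du D1 D2) as HH.
      apply is_derive_Reals in HH. evar_last; [exact HH|].
      unfold Re, Cmult; simpl. ring.
    + replace (u (fst z) (snd z) - u 0 0 - Re (sum_n (fun n => A n * RtoC (/ INR (S n)) * z ^ S n)%C N))
        with (G 1 - G 0).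
      * rewrite Hc, Rminus_0_r, Rmult_1_r.
        eapply Rle_trans; [apply re_le_Cmod|]. rewrite Cmod_mult.
        assert (Cc : Cmod (c * z) <= Cmod z) by (apply Cm; lra).
        assert (Hcz : Cmod (c * z) < rho) by lra.
        pose proof (HA (c * z)%C N Hcz) as Hb.
        rewrite (f_equal fst (Sc c) : fst (c * z)%C = c * fst z),
          (f_equal snd (Sc c) : snd (c * z)%C = c * snd z) in Hb.
        pose proof (Cmod_ge_0 (c * z)) as Z1.
        assert (K0 : 0 <= rho / (rho - Cmod (c * z))) by (apply Rle_mult_inv_pos; lra).
        assert (P0 : 0 <= (Cmod (c * z) / rho) ^ S N) by (apply pow_le, Rle_mult_inv_pos; lra).
        eapply Rle_trans; [apply Rmult_le_compat_l; [exact Z0|exact Hb]|].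
        rewrite <- (Rmult_1_l (B * (rho / (rho - Cmod z)) * _)).
        apply Rmult_le_compat; [lra| |lra|].
        { apply Rmult_le_pos; [now apply Rmult_le_pos|exact P0]. }
        apply Rmult_le_compat; [now apply Rmult_le_pos|exact P0| |].
        { apply Rmult_le_compat_l; auto. apply Rmult_le_compat_l; [lra|].
          apply Rinv_le_contravar; lra. }
        apply pow_incr. split; [apply Rle_mult_inv_pos; lra|].
        apply Rmult_le_compat_r; [left; apply Rinv_0_lt_compat; lra|lra].
      * unfold G. rewrite !Rmult_1_l, !Rmult_0_l.
        assert (Z : sum_n (fun n => A n * RtoC (/ INR (S n)) * (RtoC 0 * z) ^ S n)%C N = RtoC 0 :> C).
        { clear. induction N as [|N IH]; [rewrite csum_O|rewrite csum_S, IH];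
            rewrite Cpow_S; ring. }
        rewrite Z. rewrite (sum_n_ext (fun n => A n * RtoC (/ INR (S n)) * (1 * z) ^ S n)%C
          (fun n => A n * RtoC (/ INR (S n)) * z ^ S n)%C) by (intro; now rewrite Cmult_1_l).
        change (Re (RtoC 0)) with 0. ring.
Qed.

(** The index is shifted: [a n] and [b n] belong to the power [n + 1], the
    constant term being split off. *)
Definition hterm (a b : nat -> C) (z : C) (n : nat) : C :=
  (a n * z ^ S n + Cconj (b n * z ^ S n))%C.

Lemma complex_harmonic_expansion (g : C -> C) (rho : R) :
  harmonic_on (disk 1) g -> 0 < rho < 1 ->
  exists (a b : nat -> C) (B : R), 0 <= B /\
    a 0%nat = deriv_z g 0 /\ b 0%nat = Cconj (deriv_zbar g 0) /\
    forall (z : C) (N : nat), Cmod z < rho ->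
      Cmod (g z - g 0 - sum_n (hterm a b z) N)
      <= B * (rho / (rho - Cmod z)) * (Cmod z / rho) ^ S N.
Proof.
  intros [Hu Hv] Hr.
  destruct (harmonic_expansion _ rho Hu Hr) as (al & B1 & B10 & Ha0 & Ha).
  destruct (harmonic_expansion _ rho Hv Hr) as (be & B2 & B20 & Hb0 & Hb).
  exists (fun n => RtoC (1 / 2) * (al n + Ci * be n))%C, (fun n => RtoC (1 / 2) * (al n - Ci * be n))%C, (B1 + B2).
  (* Both parts are real parts of series, [Re X + i Re Y], and this is
     [(X + i Y) / 2 + conj ((X - i Y) / 2)]. *)
  split; [lra|]. split; [|split].
  - rewrite Ha0, Hb0. unfold deriv_z, deriv_x, deriv_y, Ci, Cmult, Cplus, Cminus, Copp, RtoC; simpl.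
    f_equal; ring.
  - rewrite Ha0, Hb0. unfold deriv_zbar, deriv_x, deriv_y, Ci, Cmult, Cplus, Cminus, Copp, RtoC, Cconj; simpl.
    f_equal; ring.
  - intros z N Hz. specialize (Ha z N Hz). specialize (Hb z N Hz).
    assert (E : sum_n (hterm (fun n => RtoC (1 / 2) * (al n + Ci * be n))%C (fun n => RtoC (1 / 2) * (al n - Ci * be n))%C z) N =
      (Re (sum_n (fun n => al n * z ^ S n)%C N), Re (sum_n (fun n => be n * z ^ S n)%C N))).
    { assert (T : forall n, hterm (fun n => RtoC (1 / 2) * (al n + Ci * be n))%C (fun n => RtoC (1 / 2) * (al n - Ci * be n))%C z n =
        (Re (al n * z ^ S n), Re (be n * z ^ S n))).
      { intro n. unfold hterm. generalize (z ^ S n)%C (al n) (be n). intros [x y] [a1 a2] [b1 b2].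
        unfold Ci, Cmult, Cplus, Cminus, Copp, RtoC, Cconj, Re; simpl. f_equal; field. }
      clear -T. induction N as [|N IH].
      - rewrite !csum_O. apply T.
      - rewrite !csum_S, IH, T. unfold Cplus, Re; simpl. reflexivity. }
    rewrite E. unfold re_part, im_part in Ha, Hb.
    rewrite <- surjective_pairing in Ha, Hb. change ((0, 0) : C) with (RtoC 0) in Ha, Hb.
    set (X := Re (sum_n (fun n => al n * z ^ S n)%C N)) in *.
    set (Y := Re (sum_n (fun n => be n * z ^ S n)%C N)) in *.
    set (q := rho / (rho - Cmod z) * (Cmod z / rho) ^ S N).
    replace ((B1 + B2) * (rho / (rho - Cmod z)) * (Cmod z / rho) ^ S N) with (B1 * q + B2 * q) by (unfold q; ring).
    apply Rle_trans with (Rabs (Re (g z) - Re (g 0) - X) + Rabs (Im (g z) - Im (g 0) - Y)).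
    + destruct (g z) as [g1 g2], (g 0) as [h1 h2]. unfold Cminus, Cplus, Copp, Re, Im; simpl.
      apply Cmod_pair_le.
      * apply Rplus_le_le_0_compat; apply Rabs_pos.
      * rewrite <- (pow2_abs (g1 + _ + _)), <- (pow2_abs (g2 + _ + _)).
        unfold Rminus.
        generalize (Rabs_pos (g1 + - h1 + - X)) (Rabs_pos (g2 + - h2 + - Y)); intros; nra.
    + unfold q. lra.
Qed.

(** * Fourier coefficients *)

Ltac ccts :=
  repeat match goal with
  | |- ccontinuous (fun _ => ?c) => apply ccontinuous_const
  | |- ccontinuous (fun t => Cplus _ _) => apply ccontinuous_plus
  | |- ccontinuous (fun t => Cmult _ _) => apply ccontinuous_mult
  | |- ccontinuous (fun t => cis (?k * t)) => exact (ccontinuous_cis k)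
  | |- ccontinuous (fun t => Cconj _) => apply ccontinuous_conj
  | H : ccontinuous ?f |- ccontinuous ?f => exact H
  | H : ccontinuous ?f |- ccontinuous (fun t => ?f t) => exact H
  end.

Lemma average_cis_dirac (k : Z) :
  average (fun t => cis (IZR k * t)) = if Z.eq_dec k 0 then 1 else 0.
Proof.
  destruct (Z.eq_dec k 0) as [->|N]; [|now apply average_cis].
  rewrite (average_ext _ (fun _ => RtoC 1)); [apply average_const|].
  intro; now rewrite Rmult_0_l, cis_0.
Qed.

Lemma hterm_circle (a b : nat -> C) (r t : R) (n : nat) :
  hterm a b (r * cis t)%C n =
  (a n * r ^ S n * cis (IZR (Z.of_nat (S n)) * t) +
   Cconj (b n) * r ^ S n * cis (IZR (- Z.of_nat (S n)) * t))%C.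
Proof.
  unfold hterm.
  rewrite opp_IZR, <- INR_IZR_INZ, Cpow_mult_l, cis_pow, !Cmult_conj, Cpow_conj.
  rewrite Ropp_mult_distr_l_reverse, cis_opp.
  rewrite Cconj_R. ring.
Qed.

Lemma ccontinuous_hterm (a b : nat -> C) (r : R) (n : nat) :
  ccontinuous (fun t => hterm a b (r * cis t)%C n).
Proof.
  apply (ccontinuous_ext _ _ (fun t => eq_sym (hterm_circle a b r t n))). ccts.
Qed.

Lemma ccontinuous_hsum (a b : nat -> C) (r : R) (N : nat) :
  ccontinuous (fun t => sum_n (hterm a b (r * cis t)%C) N).
Proof.
  induction N as [|N IH].
  - apply (ccontinuous_ext (fun t => hterm a b (r * cis t)%C 0%nat)); [|apply ccontinuous_hterm].
    intro; now rewrite csum_O.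
  - apply (ccontinuous_ext (fun t => sum_n (hterm a b (r * cis t)%C) N + hterm a b (r * cis t) (S N))%C).
    + intro; now rewrite csum_S.
    + apply ccontinuous_plus; [exact IH|apply ccontinuous_hterm].
Qed.

Lemma average_hterm (a b : nat -> C) (r : R) (n : nat) (k : Z) :
  average (fun t => hterm a b (r * cis t) n * cis (IZR k * t))%C =
  ((if Z.eq_dec k (- Z.of_nat (S n)) then a n * r ^ S n else 0) +
   (if Z.eq_dec k (Z.of_nat (S n)) then Cconj (b n) * r ^ S n else 0))%C.
Proof.
  rewrite (average_ext _ (fun t => a n * r ^ S n * cis (IZR (Z.of_nat (S n) + k) * t) +
    Cconj (b n) * r ^ S n * cis (IZR (- Z.of_nat (S n) + k) * t)))%C.
  - rewrite average_plus, !average_scal, !average_cis_dirac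
      by ccts.
    f_equal.
    + destruct (Z.eq_dec (Z.of_nat (S n) + k) 0), (Z.eq_dec k (- Z.of_nat (S n))); try lia; ring.
    + destruct (Z.eq_dec (- Z.of_nat (S n) + k) 0), (Z.eq_dec k (Z.of_nat (S n))); try lia; ring.
  - intro t. rewrite hterm_circle, !plus_IZR, !Rmult_plus_distr_r, !cis_plus. ring.
Qed.

Lemma csum_dirac (x : C) (m N : nat) :
  sum_n (fun n => if PeanoNat.Nat.eq_dec n m then x else RtoC 0) N =
  (if Compare_dec.le_dec m N then x else RtoC 0) :> C.
Proof.
  induction N as [|N IH].
  - rewrite csum_O. destruct (PeanoNat.Nat.eq_dec 0 m), (Compare_dec.le_dec m 0); auto; lia.
  - rewrite csum_S, IH.
    destruct (Compare_dec.le_dec m N), (PeanoNat.Nat.eq_dec (S N) m), (Compare_dec.le_dec m (S N)); try lia; ring.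
Qed.

Lemma average_hsum (a b : nat -> C) (r : R) (N : nat) (k : Z) :
  average (fun t => sum_n (hterm a b (r * cis t)%C) N * cis (IZR k * t))%C =
  sum_n (fun n => average (fun t => hterm a b (r * cis t) n * cis (IZR k * t))%C) N :> C.
Proof.
  induction N as [|N IH].
  - rewrite csum_O. apply average_ext; intro; now rewrite csum_O.
  - rewrite csum_S, <- IH, <- average_plus.
    + apply average_ext; intro. rewrite csum_S. ring.
    + apply ccontinuous_mult; [apply ccontinuous_hsum | apply ccontinuous_cis].
    + apply ccontinuous_mult; [apply ccontinuous_hterm | apply ccontinuous_cis].
Qed.

Lemma fourier_hsum (a b : nat -> C) (r : R) (N m : nat) : (m <= N)%nat ->
  average (fun t => sum_n (hterm a b (r * cis t)%C) N * cis (IZR (- Z.of_nat (S m)) * t))%C =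
    (a m * r ^ S m)%C /\
  average (fun t => sum_n (hterm a b (r * cis t)%C) N * cis (IZR (Z.of_nat (S m)) * t))%C =
    (Cconj (b m) * r ^ S m)%C.
Proof.
  intro H. split; rewrite average_hsum.
  - transitivity (sum_n (fun n => if PeanoNat.Nat.eq_dec n m then (a m * r ^ S m)%C else RtoC 0) N : C).
    + apply (sum_n_ext (G := C_AbelianMonoid)). intro n. rewrite average_hterm.
      match goal with |- ?x = ?y => change (x = y :> C) end.
      destruct (Z.eq_dec (- Z.of_nat (S m)) (- Z.of_nat (S n))), (PeanoNat.Nat.eq_dec n m),
        (Z.eq_dec (- Z.of_nat (S m)) (Z.of_nat (S n))); try lia; try subst n; ring.
    + rewrite csum_dirac. destruct (Compare_dec.le_dec m N); [auto|lia].
  - transitivity (sum_n (fun n => if PeanoNat.Nat.eq_dec n m then (Cconj (b m) * r ^ S m)%C else RtoC 0) N : C).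
    + apply (sum_n_ext (G := C_AbelianMonoid)). intro n. rewrite average_hterm.
      match goal with |- ?x = ?y => change (x = y :> C) end.
      destruct (Z.eq_dec (Z.of_nat (S m)) (- Z.of_nat (S n))), (PeanoNat.Nat.eq_dec n m),
        (Z.eq_dec (Z.of_nat (S m)) (Z.of_nat (S n))); try lia; try subst n; ring.
    + rewrite csum_dirac. destruct (Compare_dec.le_dec m N); [auto|lia].
Qed.

(** The frequencies [m + 1] and [- (m + 1)] carry [a m] and [conj (b m)], with
    the index shift of [hterm]. *)
Definition fourier (phi : R -> C) (a b : nat -> C) (r : R) (m : nat) : Prop :=
  average (fun t => phi t * cis (IZR (- Z.of_nat (S m)) * t))%C = (a m * r ^ S m)%C /\
  average (fun t => phi t * cis (IZR (Z.of_nat (S m)) * t))%C = (Cconj (b m) * r ^ S m)%C.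

(** Averaging is continuous for uniform convergence, so the coefficients of
    [phi] are the limits of those of the partial sums, which are constant from
    [N = m] on. *)
Lemma fourier_of_expansion (phi : R -> C) (a b : nat -> C) (r B q : R) :
  ccontinuous phi -> 0 <= q < 1 ->
  (forall (t : R) (N : nat), Cmod (phi t - sum_n (hterm a b (r * cis t)%C) N) <= B * q ^ N) ->
  forall m, fourier phi a b r m.
Proof.
  intros Hphi Hq H m.
  assert (Cl : forall k N,
    Cmod (average (fun t => phi t * cis (IZR k * t))%C -
          average (fun t => sum_n (hterm a b (r * cis t)%C) N * cis (IZR k * t))%C) <= B * q ^ N).
  { intros k N.
    replace (average (fun t => phi t * cis (IZR k * t))%C -
          average (fun t => sum_n (hterm a b (r * cis t)%C) N * cis (IZR k * t))%C)%C
      with (average (fun t => (phi t - sum_n (hterm a b (r * cis t)%C) N) * cis (IZR k * t)))%C.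
    - apply average_bound.
      + apply ccontinuous_mult; [|apply ccontinuous_cis].
        apply ccontinuous_plus; [auto|]. apply ccontinuous_opp, ccontinuous_hsum.
      + intros t _. rewrite Cmod_mult, Cmod_cis, Rmult_1_r. apply H.
    - replace (average (fun t => phi t * cis (IZR k * t))%C -
          average (fun t => sum_n (hterm a b (r * cis t)%C) N * cis (IZR k * t))%C)%C with
        (average (fun t => phi t * cis (IZR k * t))%C + RtoC (-1) *
          average (fun t => sum_n (hterm a b (r * cis t)%C) N * cis (IZR k * t))%C)%C by ring.
      assert (ccontinuous (fun t => sum_n (hterm a b (r * cis t)%C) N * cis (IZR k * t))%C)
        by (apply ccontinuous_mult; [apply ccontinuous_hsum | apply ccontinuous_cis]).
      rewrite <- average_scal, <- average_plus; auto.
      + apply average_ext; intro; ring.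
      + apply ccontinuous_mult; [auto | apply ccontinuous_cis].
      + apply ccontinuous_mult; [apply ccontinuous_const | auto]. }
  split; apply (eq_of_geometric _ _ (B * q ^ m) q Hq); intro N;
    rewrite Rmult_assoc, <- pow_add.
  - rewrite <- (proj1 (fourier_hsum a b r (m + N) m ltac:(lia))). apply Cl.
  - rewrite <- (proj2 (fourier_hsum a b r (m + N) m ltac:(lia))). apply Cl.
Qed.

(** * Coefficient bounds *)

Fixpoint energy (a b : nat -> C) (r : R) (N : nat) : R :=
  (Cmod (a N) ^ 2 + Cmod (b N) ^ 2) * (r ^ S N) ^ 2 +
  match N with O => 0 | S N' => energy a b r N' end.

(** Only the first [N + 1] pairs of coefficients of [phi] enter, so this applies
    equally to [phi] equal to the partial sum itself. *)
Lemma average_conj_hsum (phi : R -> C) (a b : nat -> C) (r : R) (N : nat) :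
  ccontinuous phi -> (forall m, (m <= N)%nat -> fourier phi a b r m) ->
  average (fun t => phi t * Cconj (sum_n (hterm a b (r * cis t)%C) N))%C = energy a b r N.
Proof.
  intros Hphi HF.
  assert (T : forall n, fourier phi a b r n ->
    average (fun t => phi t * Cconj (hterm a b (r * cis t) n))%C =
    ((Cmod (a n) ^ 2 + Cmod (b n) ^ 2) * (r ^ S n) ^ 2)%R).
  { intros n [F1 F2].
    rewrite (average_ext _ (fun t =>
      (Cconj (a n) * r ^ S n) * (phi t * cis (IZR (- Z.of_nat (S n)) * t)) +
      (b n * r ^ S n) * (phi t * cis (IZR (Z.of_nat (S n)) * t))))%C.
    - rewrite average_plus, !average_scal, F1, F2.
      + rewrite RtoC_mult, RtoC_plus, !RtoC_pow, <- !RtoC_pow, !Cmod2_conj, !RtoC_pow. ring.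
      + apply ccontinuous_mult; [auto | apply ccontinuous_cis].
      + apply ccontinuous_mult; [auto | apply ccontinuous_cis].
      + apply ccontinuous_mult; [apply ccontinuous_const|].
        apply ccontinuous_mult; [auto | apply ccontinuous_cis].
      + apply ccontinuous_mult; [apply ccontinuous_const|].
        apply ccontinuous_mult; [auto | apply ccontinuous_cis].
    - intro t. rewrite hterm_circle, opp_IZR, Ropp_mult_distr_l_reverse, cis_opp.
      rewrite <- RtoC_pow.
      rewrite Cplus_conj, !Cmult_conj, !Cconj_conj.
      rewrite !Cconj_R. ring. }
  assert (CT : forall n, ccontinuous (fun t => phi t * Cconj (hterm a b (r * cis t) n))%C).
  { intro n. apply ccontinuous_mult; auto. apply ccontinuous_conj, ccontinuous_hterm. }
  induction N as [|N IH].
  - change (energy a b r 0) with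
      ((Cmod (a 0%nat) ^ 2 + Cmod (b 0%nat) ^ 2) * (r ^ 1) ^ 2 + 0).
    rewrite Rplus_0_r, <- T by auto.
    apply average_ext; intro; now rewrite csum_O.
  - change (energy a b r (S N)) with
      ((Cmod (a (S N)) ^ 2 + Cmod (b (S N)) ^ 2) * (r ^ S (S N)) ^ 2 + energy a b r N).
    rewrite RtoC_plus, <- IH by auto. rewrite <- T by auto. rewrite <- average_plus; auto.
    + apply average_ext; intro. rewrite csum_S, Cplus_conj. ring.
    + apply ccontinuous_mult; auto. apply ccontinuous_conj, ccontinuous_hsum.
Qed.

(** Pointwise [Re (phi conj T) <= (M^2 + |T|^2) / 2]; on average this reads
    [e <= M^2 / 2 + e / 2]. *)
Lemma bessel_abstract (phi T : R -> C) (e M : R) :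
  ccontinuous phi -> ccontinuous T ->
  average (fun t => phi t * Cconj (T t))%C = e ->
  average (fun t => T t * Cconj (T t))%C = e ->
  (forall t, Cmod (phi t) <= M) -> e <= M ^ 2.
Proof.
  intros Hphi CT E1 E2 HM.
  assert (C1 : ccontinuous (fun t => phi t * Cconj (T t))%C)
    by (apply ccontinuous_mult; auto; now apply ccontinuous_conj).
  assert (C2 : ccontinuous (fun t => RtoC (- / 2) * (T t * Cconj (T t)))%C).
  { apply ccontinuous_mult; [apply ccontinuous_const|].
    apply ccontinuous_mult; auto; now apply ccontinuous_conj. }
  assert (H : Re (average (fun t => phi t * Cconj (T t) + RtoC (- / 2) * (T t * Cconj (T t)))%C)
    <= / (2 * PI) * RInt (fun _ => M ^ 2 / 2) 0 (2 * PI)).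
  { apply Re_average_le.
    - now apply ccontinuous_plus.
    - intro; apply continuous_const.
    - intros t _. rewrite <- Cmod2_conj. specialize (HM t).
      pose proof (Cmod_ge_0 (phi t)) as P.
      assert (Q : Cmod (phi t) ^ 2 <= M ^ 2) by (apply pow_incr; lra).
      rewrite !Cmod2_alt in *. destruct (phi t) as [x y], (T t) as [c d].
      unfold Re, Im, Cplus, Cmult, Cconj, RtoC in *. simpl in *.
      pose proof (pow2_ge_0 (x - c)). pose proof (pow2_ge_0 (y - d)). nra. }
  rewrite average_plus, E1, average_scal, E2 in H; auto.
  - rewrite <- RtoC_mult, <- RtoC_plus, RInt_const in H.
    unfold scal, RtoC, Re in H; simpl in H; unfold mult in H; simpl in H.
    pose proof PI_RGT_0.
    replace (/ (2 * PI) * ((2 * PI - 0) * (M * (M * 1) / 2))) with (M ^ 2 / 2) in H by (field; lra).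
    lra.
  - apply ccontinuous_mult; auto; now apply ccontinuous_conj.
Qed.

Lemma bessel (phi : R -> C) (a b : nat -> C) (r M : R) (N : nat) :
  ccontinuous phi -> (forall m, fourier phi a b r m) ->
  (forall t, Cmod (phi t) <= M) -> energy a b r N <= M ^ 2.
Proof.
  intros Hphi HF HM.
  assert (HF' : forall m, (m <= N)%nat ->
    fourier (fun t => sum_n (hterm a b (r * cis t)%C) N) a b r m)
    by exact (fun m Hm => fourier_hsum a b r N m Hm).
  exact (bessel_abstract phi _ _ M Hphi (ccontinuous_hsum a b r N)
    (average_conj_hsum phi a b r N Hphi (fun m _ => HF m))
    (average_conj_hsum _ a b r N (ccontinuous_hsum a b r N) HF') HM).
Qed.

Lemma continuous_abs_cos (t : R) : continuous (fun t => Rabs (cos t)) t.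
Proof. apply (continuous_comp cos Rabs); [apply continuous_cos | apply continuous_Rabs]. Qed.

(** As [|cos|] has period [PI], its integral over a period may be taken from
    [- PI / 2] to [PI / 2], where the absolute value disappears. *)
Lemma RInt_abs_cos_shift (x : R) (n : nat) :
  RInt (fun t => Rabs (cos t)) x (x + INR n * PI) = 2 * INR n.
Proof.
  pose (P := fun x => RInt (fun t => Rabs (cos t)) 0 x).
  assert (Ex : forall a b, ex_RInt (fun t => Rabs (cos t)) a b) by (intros; apply ex_RInt_cont, continuous_abs_cos).
  assert (Ch : forall a b, RInt (fun t => Rabs (cos t)) a b = P b - P a).
  { intros a b.
    assert (E : P a + RInt (fun t => Rabs (cos t)) a b = P b)
      by exact (RInt_Chasles (V := R_CompleteNormedModule) _ 0 a b (Ex _ _) (Ex _ _)).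
    lra. }
  assert (DP : forall x, is_derive P x (Rabs (cos x))).
  { intro y. apply (is_derive_RInt (V := R_NormedModule) (fun t => Rabs (cos t)) P 0 y).
    - apply filter_forall; intro z. exact (RInt_correct (V := R_CompleteNormedModule) (fun t => Rabs (cos t)) 0 z (Ex _ _)).
    - apply continuous_abs_cos. }
  assert (St : forall x, P (x + PI) - P x = 2).
  { intro y. transitivity (P (- (PI / 2) + PI) - P (- (PI / 2))).
    - pose (G := fun x => P (x + PI) - P x).
      assert (DG : forall x, is_derive G x 0).
      { intro z. unfold G.
        replace 0 with (1 * Rabs (cos (z + PI)) - Rabs (cos z)).
        - apply (is_derive_minus (K := R_AbsRing) (V := R_NormedModule) (fun x => P (x + PI)) P); [|apply DP].
          apply (is_derive_comp (K := R_AbsRing) (V := R_NormedModule) P (fun x => x + PI)); [apply DP|].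
          auto_derive; [trivial|ring].
        - rewrite neg_cos, Rabs_Ropp. ring. }
      change (G y = G (- (PI / 2))).
      destruct (MVT_gen G (- (PI / 2)) y (fun _ => 0)) as (c & _ & Hc).
      + intros; apply DG.
      + intros z _. apply continuity_pt_filterlim.
        apply (ex_derive_continuous (K := R_AbsRing) (V := R_NormedModule)). eexists; apply DG.
      + lra.
    - rewrite <- Ch. replace (- (PI / 2) + PI) with (PI / 2) by lra.
      rewrite (RInt_ext _ cos).
      + apply is_RInt_unique.
        evar_last; [apply (is_RInt_derive (V := R_CompleteNormedModule) sin cos)|].
        * intros; apply is_derive_sin.
        * intros; apply continuous_cos.
        * rewrite sin_neg, sin_PI2. unfold minus, plus, opp; simpl; ring.
      + intros t Ht. pose proof PI_RGT_0.
        rewrite Rmin_left, Rmax_right in Ht by lra.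
        apply Rabs_pos_eq, cos_ge_0; lra. }
  rewrite Ch. induction n as [|n IH].
  - simpl. rewrite Rmult_0_l, Rplus_0_r. ring.
  - rewrite S_INR. specialize (St (x + INR n * PI)).
    replace (x + (INR n + 1) * PI) with (x + INR n * PI + PI) by ring. lra.
Qed.

Lemma RInt_abs_cos (n : nat) (gamma : R) : (0 < n)%nat ->
  RInt (fun t => Rabs (cos (INR n * t + gamma))) 0 (2 * PI) = 4.
Proof.
  intro Hn. assert (N : INR n <> 0) by (apply not_0_INR; lia).
  apply (Rmult_eq_reg_l (INR n)); auto.
  assert (C1 : forall t, continuous (fun t => Rabs (cos (INR n * t + gamma))) t).
  { intro t. apply (continuous_comp (fun t => INR n * t + gamma) (fun t => Rabs (cos t))); [cts|apply continuous_abs_cos]. }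
  transitivity (RInt (fun t => scal (INR n) (Rabs (cos (INR n * t + gamma)))) 0 (2 * PI)).
  - rewrite (RInt_scal (V := R_CompleteNormedModule)) by now apply ex_RInt_cont.
    reflexivity.
  - etransitivity; [exact (RInt_comp_lin (V := R_CompleteNormedModule) (fun t => Rabs (cos t))
      (INR n) gamma 0 (2 * PI) (ex_RInt_cont _ _ _ continuous_abs_cos))|].
    replace (INR n * 0 + gamma) with gamma by ring.
    replace (INR n * (2 * PI) + gamma) with (gamma + INR (2 * n) * PI)
      by (rewrite mult_INR; simpl; ring).
    rewrite RInt_abs_cos_shift, mult_INR. simpl. ring.
Qed.

Lemma exists_angle (u : C) : Cmod u = 1 -> exists x, u = cis x.
Proof.
  intro Hu. assert (E : fst u ^ 2 + snd u ^ 2 = 1).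
  { generalize (Cmod2_alt u). rewrite Hu. unfold Re, Im. lra. }
  destruct u as [c s]; simpl fst in E; simpl snd in E.
  assert (B : -1 <= c <= 1) by (split; nra).
  destruct (Rle_dec 0 s) as [P|P].
  - exists (acos c). unfold cis. rewrite cos_acos, sin_acos by auto.
    f_equal. symmetry. apply sqrt_lem_1; unfold Rsqr; nra.
  - exists (- acos c). unfold cis. rewrite cos_neg, sin_neg, cos_acos, sin_acos by auto.
    f_equal. assert (sqrt (1 - Rsqr c) = - s); [|lra].
    apply sqrt_lem_1; unfold Rsqr; nra.
Qed.

Lemma cis_sum (x y : R) : (cis x + cis y)%C = (RtoC (2 * cos ((y - x) / 2)) * cis ((x + y) / 2))%C.
Proof.
  transitivity (cis ((x + y) / 2 - (y - x) / 2) + cis ((x + y) / 2 + (y - x) / 2))%C.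
  { f_equal; f_equal; field. }
  generalize ((x + y) / 2) ((y - x) / 2); intros m d.
  unfold cis, Cplus, Cmult, RtoC; simpl.
  rewrite cos_minus, cos_plus, sin_minus, sin_plus. f_equal; ring.
Qed.

(** Rotated so that both coefficients become positive, their sum is the mean
    of the function against a kernel of modulus [2 |cos (n t + gamma)|]. *)
Lemma heinz_bound (phi : R -> C) (a b : nat -> C) (r M : R) (m : nat) :
  ccontinuous phi -> fourier phi a b r m -> 0 <= r ->
  (forall t, Cmod (phi t) <= M) ->
  (Cmod (a m) + Cmod (b m)) * r ^ S m <= 4 * M / PI.
Proof.
  intros Hphi [F1 F2] Hr HM. pose proof PI_RGT_0.
  destruct (exists_rotation (a m)) as (u1 & U1 & E1).
  destruct (exists_rotation (Cconj (b m))) as (u2 & U2 & E2). rewrite Cmod_conj in E2.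
  destruct (exists_angle u1 U1) as (x & ->). destruct (exists_angle u2 U2) as (y & ->).
  set (k := Z.of_nat (S m)) in *.
  assert (C1 : forall k, ccontinuous (fun t => phi t * cis (IZR k * t))%C) by (intro; ccts).
  assert (E : average (fun t => phi t * (cis (x + IZR (- k) * t) + cis (y + IZR k * t)))%C =
    RtoC ((Cmod (a m) + Cmod (b m)) * r ^ S m)).
  { rewrite (average_ext _ (fun t => cis x * (phi t * cis (IZR (- k) * t)) +
      cis y * (phi t * cis (IZR k * t))))%C.
    - rewrite average_plus, !average_scal, F1, F2 by (auto; apply ccontinuous_mult; auto; ccts).
      rewrite RtoC_mult, RtoC_plus, <- E1, <- E2, RtoC_pow. ring.
    - intro t. rewrite !cis_plus. ring. }
  assert (L : Re (average (fun t => phi t * (cis (x + IZR (- k) * t) + cis (y + IZR k * t)))%C) <=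
    / (2 * PI) * RInt (fun t => 2 * M * Rabs (cos (INR (S m) * t + (y - x) / 2))) 0 (2 * PI)).
  { apply Re_average_le.
    - apply (ccontinuous_ext (fun t => phi t * (cis x * cis (IZR (- k) * t) + cis y * cis (IZR k * t))))%C.
      + intro; now rewrite !cis_plus.
      + ccts.
    - intro t. apply continuous_Rmult; [apply continuous_const|].
      apply (continuous_comp (fun t => INR (S m) * t + (y - x) / 2) (fun t => Rabs (cos t))); [cts|].
      apply continuous_abs_cos.
    - intros t _. eapply Rle_trans; [apply Re_le_Cmod|].
      rewrite cis_sum, !Cmod_mult, Cmod_cis, Cmod_R, Rabs_mult, (Rabs_pos_eq 2), Rmult_1_r by lra.
      replace ((y + IZR k * t - (x + IZR (- k) * t)) / 2) with (INR (S m) * t + (y - x) / 2).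
      + specialize (HM t). pose proof (Rabs_pos (cos (INR (S m) * t + (y - x) / 2))). nra.
      + unfold k. rewrite opp_IZR, <- INR_IZR_INZ. field. }
  rewrite E in L. change (Re (RtoC ?x)) with x in L.
  rewrite (RInt_scal (V := R_CompleteNormedModule) (fun t => Rabs (cos (INR (S m) * t + (y - x) / 2)))) in L.
  - rewrite RInt_abs_cos in L by lia. eapply Rle_trans; [exact L|].
    unfold scal; simpl; unfold mult; simpl. right. field. lra.
  - apply ex_RInt_cont. intro t.
    apply (continuous_comp (fun t => INR (S m) * t + (y - x) / 2) (fun t => Rabs (cos t))); [cts|].
    apply continuous_abs_cos.
Qed.

Lemma pow_lower (h : R) (k : nat) : 0 <= h <= 1 -> 1 - INR k * h <= (1 - h) ^ k.
Proof.
  intro Hh. induction k as [|k IH]; [simpl; lra|].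
  rewrite S_INR. simpl pow. pose proof (pos_INR k).
  assert ((1 - h) * (1 - INR k * h) <= (1 - h) * (1 - h) ^ k) by (apply Rmult_le_compat_l; lra).
  assert (0 <= INR k * h * h) by (repeat apply Rmult_le_pos; lra). nra.
Qed.

(** Letting [r] tend to 1; the witness [r = 1 - h] is read off Bernoulli's
    inequality. *)
Lemma le_of_radius_limit (x y : R) (k : nat) :
  0 <= y -> (forall r, 0 < r < 1 -> x * r ^ k <= y) -> x <= y.
Proof.
  intros Hy H. apply Rnot_lt_le; intro L.
  pose proof (pos_INR k) as Hk.
  set (h := (x - y) / (x * (INR k + 2))).
  assert (X : 0 < x * (INR k + 2)) by (apply Rmult_lt_0_compat; lra).
  assert (Eh : h * (x * (INR k + 2)) = x - y) by (unfold h; field; lra).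
  assert (H0 : 0 < h) by (apply Rdiv_lt_0_compat; lra).
  assert (H1 : h < 1).
  { apply (Rmult_lt_reg_r (x * (INR k + 2))); auto. rewrite Eh. nra. }
  specialize (H (1 - h) ltac:(lra)).
  assert (P : 1 - INR k * h <= (1 - h) ^ k) by (apply pow_lower; lra).
  assert (x * (1 - INR k * h) <= x * (1 - h) ^ k) by (apply Rmult_le_compat_l; lra).
  assert (0 < h * x) by (apply Rmult_lt_0_compat; lra). nra.
Qed.

(** A quantitative form of locally uniform convergence: bounds on partial sums
    pass to [g] by letting the error [B * q ^ N] tend to 0. *)
Definition series_on_disk (g : C -> C) (a b : nat -> C) : Prop :=
  forall r, 0 <= r < 1 -> exists B q, 0 <= q < 1 /\
    forall z (N : nat), Cmod z <= r -> Cmod (g z - sum_n (hterm a b z) N) <= B * q ^ N.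

(** The expansions found on the disks of radius [rho < 1] have the same
    coefficients, because each of them determines the Fourier coefficients of [g]
    on one fixed circle. *)
Lemma bounded_harmonic_series (g : C -> C) (M : R) :
  harmonic_on (disk 1) g -> g 0 = 0 -> (forall z, disk 1 z -> Cmod (g z) <= M) ->
  exists a b : nat -> C,
    a 0%nat = deriv_z g 0 /\ b 0%nat = Cconj (deriv_zbar g 0) /\
    series_on_disk g a b /\
    (forall m, Cmod (a m) + Cmod (b m) <= 4 * M / PI) /\
    Cmod (a 0%nat) ^ 2 + Cmod (b 0%nat) ^ 2 <= M ^ 2 /\
    (forall m, (0 < m)%nat -> (Cmod (a 0%nat) ^ 2 + Cmod (b 0%nat) ^ 2) +
      (Cmod (a m) ^ 2 + Cmod (b m) ^ 2) <= M ^ 2).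
Proof.
  intros Hg H0 HM.
  assert (M0 : 0 <= M).
  { eapply Rle_trans; [apply (Cmod_ge_0 (g 0))|]. apply HM. unfold disk; rewrite Cmod_0; lra. }
  assert (Ex : forall rho, 0 < rho < 1 -> exists a b : nat -> C,
    a 0%nat = deriv_z g 0 /\ b 0%nat = Cconj (deriv_zbar g 0) /\
    forall r, 0 <= r < rho -> exists B q, 0 <= q < 1 /\
      forall z (N : nat), Cmod z <= r -> Cmod (g z - sum_n (hterm a b z) N) <= B * q ^ N).
  { intros rho Hr. destruct (complex_harmonic_expansion g rho Hg Hr) as (a & b & B & B0 & A0 & A1 & H).
    exists a, b. split; [auto|split; [auto|]]. intros r Hrr.
    exists (B * (rho / (rho - r))), (r / rho). split.
    - split; [apply Rle_mult_inv_pos; lra|].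
      apply (Rmult_lt_reg_r rho); [lra|]. unfold Rdiv. rewrite Rmult_assoc, Rinv_l; lra.
    - intros z N Hz. pose proof (Cmod_ge_0 z).
      specialize (H z N ltac:(lra)). rewrite H0 in H.
      replace (g z - RtoC 0 - sum_n (hterm a b z) N)%C with (g z - sum_n (hterm a b z) N)%C in H
        by (unfold Cminus; rewrite Copp_0, Cplus_0_r; reflexivity).
      eapply Rle_trans; [exact H|].
      assert (Q1 : 0 <= Cmod z / rho) by (apply Rle_mult_inv_pos; lra).
      assert (Q2 : Cmod z / rho <= r / rho)
        by (apply Rmult_le_compat_r; [left; apply Rinv_0_lt_compat|]; lra).
      assert (Q3 : r / rho <= 1).
      { apply (Rmult_le_reg_r rho); [lra|]. unfold Rdiv. rewrite Rmult_assoc, Rinv_l; lra. }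
      apply Rmult_le_compat.
      + apply Rmult_le_pos; [auto|apply Rle_mult_inv_pos; lra].
      + now apply pow_le.
      + apply Rmult_le_compat_l; auto. apply Rmult_le_compat_l; [lra|].
        apply Rinv_le_contravar; lra.
      + assert ((Cmod z / rho) ^ N <= (r / rho) ^ N) by (apply pow_incr; lra).
        assert (0 <= (Cmod z / rho) ^ N) by now apply pow_le.
        simpl. nra. }
  assert (Cg : forall r, 0 < r < 1 -> ccontinuous (fun t => g (r * cis t)%C)).
  { intros r Hr t.
    assert (Hd : forall t, disk 1 (r * cos t, r * sin t)).
    { intro s. unfold disk. apply Rle_lt_trans with r; [|lra].
      apply Cmod_pair_le; [lra|]. generalize (sin2_cos2 s); unfold Rsqr; intro; nra. }
    assert (Ec : forall t, (r * cis t)%C = (r * cos t, r * sin t))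
      by (intro; unfold cis, Cmult, RtoC; simpl; f_equal; ring).
    destruct Hg as [Hu Hv]. split.
    - apply (continuous_ext (fun t => re_part g (r * cos t) (r * sin t)));
        [intro; now rewrite Ec|].
      apply (continuous_comp_2 (fun t => r * cos t) (fun t => r * sin t) (re_part g)); [cts|cts|].
      apply continuity_2d_pt_filterlim. exact (proj1 (proj1 (Hu _ _ (Hd t)))).
    - apply (continuous_ext (fun t => im_part g (r * cos t) (r * sin t)));
        [intro; now rewrite Ec|].
      apply (continuous_comp_2 (fun t => r * cos t) (fun t => r * sin t) (im_part g)); [cts|cts|].
      apply continuity_2d_pt_filterlim. exact (proj1 (proj1 (Hv _ _ (Hd t)))). }
  assert (Cr : forall r t, 0 < r -> Cmod (r * cis t) = r).
  { intros r t Hr. rewrite Cmod_mult, Cmod_cis, Cmod_R, Rabs_pos_eq; lra. }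
  assert (Fo : forall a b r, 0 < r < 1 -> (exists B q, 0 <= q < 1 /\
      forall z (N : nat), Cmod z <= r -> Cmod (g z - sum_n (hterm a b z) N) <= B * q ^ N) ->
      forall m, fourier (fun t => g (r * cis t)%C) a b r m).
  { intros a b r Hr (B & q & Hq & H) m.
    apply (fourier_of_expansion _ a b r B q); auto.
    intros t N. apply H. rewrite Cr; lra. }
  (* The circle of radius 1/2 lies inside all the disks of expansion used
     here, so it identifies the coefficients obtained from each of them. *)
  destruct (Ex (3 / 4) ltac:(lra)) as (a & b & A0 & B0 & Hs).
  assert (Fh : forall m, fourier (fun t => g (RtoC (1 / 2) * cis t)%C) a b (1 / 2) m)
    by (apply Fo; [lra|apply Hs; lra]).
  assert (Sr : series_on_disk g a b).
  { intros r Hr. destruct (Ex ((3 + r) / 4) ltac:(lra)) as (a' & b' & _ & _ & Hs').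
    assert (Fh' : forall m, fourier (fun t => g (RtoC (1 / 2) * cis t)%C) a' b' (1 / 2) m)
      by (apply Fo; [lra|apply Hs'; lra]).
    assert (Pz : forall m, ((1 / 2)%R ^ S m)%C <> 0)
      by (intro m; apply Cpow_nz; intro Q; apply RtoC_inj in Q; lra).
    assert (Can : forall (x y : C) m, (x * (1 / 2)%R ^ S m = y * (1 / 2)%R ^ S m)%C -> x = y).
    { intros x y m E. transitivity (x * (1 / 2)%R ^ S m / (1 / 2)%R ^ S m)%C; [field; apply Pz|].
      rewrite E. field; apply Pz. }
    assert (Ea : forall m, a' m = a m).
    { intro m. apply (Can _ _ m). now rewrite <- (proj1 (Fh m)), <- (proj1 (Fh' m)). }
    assert (Eb : forall m, b' m = b m).
    { intro m. rewrite <- (Cconj_conj (b' m)), <- (Cconj_conj (b m)). f_equal. apply (Can _ _ m).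
      now rewrite <- (proj2 (Fh m)), <- (proj2 (Fh' m)). }
    destruct (Hs' r ltac:(lra)) as (B & q & Hq & H). exists B, q. split; auto.
    intros z N Hz. rewrite (sum_n_ext (hterm a b z) (hterm a' b' z)); [now apply H|].
    intro n. unfold hterm. now rewrite Ea, Eb. }
  assert (Bd : forall r, 0 < r < 1 -> forall t, Cmod (g (r * cis t)%C) <= M).
  { intros r Hr t. apply HM. unfold disk. rewrite Cr; lra. }
  assert (Fr : forall r, 0 < r < 1 -> forall m, fourier (fun t => g (r * cis t)%C) a b r m).
  { intros r Hr. apply Fo; auto. apply Sr; lra. }
  pose proof PI_RGT_0.
  exists a, b. split; [auto|]. split; [auto|]. split; [auto|]. split; [|split].
  - intro m. apply (le_of_radius_limit _ _ (S m)).
    + apply Rle_mult_inv_pos; lra.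
    + intros r Hr. apply (heinz_bound (fun t => g (r * cis t)%C)); auto; lra.
  - apply (le_of_radius_limit _ _ 2); [apply pow2_ge_0|].
    intros r Hr. generalize (bessel _ a b r M 0 (Cg r Hr) (Fr r Hr) (Bd r Hr)).
    unfold energy. rewrite pow_1. lra.
  - intros m Hm. apply (le_of_radius_limit _ _ (S m * 2)); [apply pow2_ge_0|].
    intros r Hr. eapply Rle_trans; [|apply (bessel _ a b r M m (Cg r Hr) (Fr r Hr) (Bd r Hr))].
    destruct m as [|m]; [lia|]. clear Hm.
    change (energy a b r (S m)) with
      ((Cmod (a (S m)) ^ 2 + Cmod (b (S m)) ^ 2) * (r ^ S (S m)) ^ 2 + energy a b r m).
    rewrite pow_mult, Rmult_plus_distr_r.
    enough ((Cmod (a 0%nat) ^ 2 + Cmod (b 0%nat) ^ 2) * (r ^ S (S m)) ^ 2 <= energy a b r m) by lra.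
    assert (E0 : (Cmod (a 0%nat) ^ 2 + Cmod (b 0%nat) ^ 2) * (r ^ S (S m)) ^ 2 <= energy a b r 0).
    { unfold energy. rewrite Rplus_0_r. apply Rmult_le_compat_l.
      - generalize (pow2_ge_0 (Cmod (a 0%nat))) (pow2_ge_0 (Cmod (b 0%nat))); lra.
      - apply pow_incr. split; [apply pow_le; lra|].
        rewrite pow_1. change (r ^ S (S m)) with (r * r ^ S m).
        assert (0 <= r ^ S m <= 1); [|nra].
        split; [apply pow_le; lra|]. rewrite <- (pow1 (S m)). apply pow_incr; lra. }
    eapply Rle_trans; [exact E0|]. clear E0.
    induction m as [|m IH]; [lra|].
    change (energy a b r (S m)) with
      ((Cmod (a (S m)) ^ 2 + Cmod (b (S m)) ^ 2) * (r ^ S (S m)) ^ 2 + energy a b r m).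
    enough (0 <= (Cmod (a (S m)) ^ 2 + Cmod (b (S m)) ^ 2) * (r ^ S (S m)) ^ 2) by lra.
    apply Rmult_le_pos; [|apply pow2_ge_0].
    generalize (pow2_ge_0 (Cmod (a (S m)))) (pow2_ge_0 (Cmod (b (S m)))); lra.
Qed.

(** * The change of variable zeta = |z|^2 z *)

Definition cubed (z : C) : C := (RtoC (Cmod z ^ 2) * z)%C.

Lemma Cmod_cubed (z : C) : Cmod (cubed z) = Cmod z ^ 3.
Proof.
  unfold cubed. rewrite Cmod_mult, Cmod_R, Rabs_pos_eq by apply pow2_ge_0. ring.
Qed.

(** With [p = |z1|^2], [q = |z2|^2] and [c] the real part of [z1 conj z2], the
    squares differ by [(p - q) (p (p + q) - 2 c q)], and [2 c <= p + q]. *)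
Lemma cubed_dist_lower_bound (z1 z2 : C) : Cmod z2 <= Cmod z1 ->
  Cmod z2 ^ 2 * Cmod (z1 - z2) <= Cmod (cubed z1 - cubed z2).
Proof.
  intro H. pose proof (Cmod_ge_0 z2) as P2.
  assert (Q : Cmod z2 ^ 2 <= Cmod z1 ^ 2) by (apply pow_incr; lra).
  apply Rsqr_incr_0_var; [|apply Cmod_ge_0].
  rewrite !Rsqr_pow2, Rpow_mult_distr. unfold cubed.
  pose proof (pow2_ge_0 (Cmod z2)) as Q0.
  pose proof (Cmod2_alt z1) as E1. pose proof (Cmod2_alt z2) as E2.
  rewrite !(Cmod2_alt (_ - _)).
  set (p := Cmod z1 ^ 2) in *. set (q := Cmod z2 ^ 2) in *.
  destruct z1 as [x1 y1], z2 as [x2 y2].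
  unfold Re, Im, Cminus, Cplus, Copp, Cmult, RtoC in *; simpl fst in *; simpl snd in *.
  set (c := x1 * x2 + y1 * y2).
  assert (Hc : 2 * c <= p + q).
  { rewrite E1, E2. unfold c.
    generalize (pow2_ge_0 (x1 - x2)) (pow2_ge_0 (y1 - y2)); lra. }
  replace ((x1 + - x2) ^ 2 + (y1 + - y2) ^ 2) with (p + q - 2 * c)
    by (rewrite E1, E2; unfold c; ring).
  replace ((p * x1 - 0 * y1 + - (q * x2 - 0 * y2)) ^ 2 + (p * y1 + 0 * x1 + - (q * y2 + 0 * x2)) ^ 2)
    with (p ^ 2 * (x1 ^ 2 + y1 ^ 2) + q ^ 2 * (x2 ^ 2 + y2 ^ 2) - 2 * p * q * c) by (unfold c; ring).
  rewrite <- E1, <- E2. clearbody p q c.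
  assert (0 <= (p - q) * (p * (p + q) - 2 * c * q)).
  { apply Rmult_le_pos; [lra|].
    assert (2 * c * q <= (p + q) * q) by (apply Rmult_le_compat_r; lra).
    assert ((p + q) * q <= (p + q) * p) by (apply Rmult_le_compat_l; lra). lra. }
  nra.
Qed.

(** Measured against [cubed], the map [z |-> |z|^2 z^(n+1)] is as Lipschitz as
    [z^(n+1)] is on the disk of radius [r]. *)
Lemma cubed_power_lipschitz (z1 z2 : C) (r : R) (n : nat) :
  Cmod z1 <= r -> Cmod z2 <= r ->
  Cmod (RtoC (Cmod z1 ^ 2) * z1 ^ S n - RtoC (Cmod z2 ^ 2) * z2 ^ S n)
  <= INR (S n) * r ^ n * Cmod (cubed z1 - cubed z2).
Proof.
  intros H1 H2.
  assert (W : forall z1 z2, Cmod z1 <= r -> Cmod z2 <= Cmod z1 ->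
    Cmod (RtoC (Cmod z1 ^ 2) * z1 ^ S n - RtoC (Cmod z2 ^ 2) * z2 ^ S n)
    <= INR (S n) * r ^ n * Cmod (cubed z1 - cubed z2)).
  { clear z1 z2 H1 H2; intros z1 z2 H1 H. pose proof (cubed_dist_lower_bound z1 z2 H) as X.
    pose proof (Cmod_ge_0 z1) as P1. pose proof (Cmod_ge_0 z2) as P2.
    set (J := Cmod (cubed z1 - cubed z2)) in *.
    assert (J0 : 0 <= J) by apply Cmod_ge_0.
    induction n as [|n IH].
    - rewrite !Cpow_1_r. unfold J, cubed. simpl INR. simpl (r ^ 0). lra.
    - replace (RtoC (Cmod z1 ^ 2) * z1 ^ S (S n) - RtoC (Cmod z2 ^ 2) * z2 ^ S (S n))%C with
        (z1 * (RtoC (Cmod z1 ^ 2) * z1 ^ S n - RtoC (Cmod z2 ^ 2) * z2 ^ S n) +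
         z2 ^ S n * (RtoC (Cmod z2 ^ 2) * (z1 - z2)))%C by (rewrite !(Cpow_S _ (S n)); ring).
      eapply Rle_trans; [apply Cmod_triangle|].
      rewrite !(Cmod_mult z1), !(Cmod_mult (z2 ^ S n)), Cmod_pow, (Cmod_mult (RtoC _)), Cmod_R,
        (Rabs_pos_eq _ (pow2_ge_0 (Cmod z2))).
      assert (A1 : Cmod z1 * Cmod (RtoC (Cmod z1 ^ 2) * z1 ^ S n - RtoC (Cmod z2 ^ 2) * z2 ^ S n)
        <= r * (INR (S n) * r ^ n * J)).
      { apply Rmult_le_compat; auto using Cmod_ge_0. }
      assert (A2 : Cmod z2 ^ S n * (Cmod z2 ^ 2 * Cmod (z1 - z2)) <= r ^ S n * J).
      { apply Rmult_le_compat; auto.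
        - now apply pow_le.
        - apply Rmult_le_pos; [apply pow2_ge_0 | apply Cmod_ge_0].
        - apply pow_incr; lra. }
      rewrite (S_INR (S n)). simpl (r ^ S n) in *. lra. }
  destruct (Rle_dec (Cmod z2) (Cmod z1)) as [L|L]; [now apply W|].
  assert (Sym : forall u v : C, Cmod (u - v) = Cmod (v - u))
    by (intros; rewrite <- Cmod_opp; f_equal; ring).
  rewrite Sym, (Sym (cubed z1)). apply W; lra.
Qed.

(** * The remainder as a Lipschitz perturbation *)

Definition linear_part (a b : nat -> C) (z : C) : C := (a 0%nat * z + Cconj (b 0%nat * z))%C.

Definition remainder (g : C -> C) (a b : nat -> C) (z : C) : C :=
  (F g z - linear_part a b (cubed z))%C.

Lemma Cmod_hterm_le (a b : nat -> C) (z : C) (n : nat) :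
  Cmod (hterm a b z n) <= (Cmod (a n) + Cmod (b n)) * Cmod z ^ S n.
Proof.
  unfold hterm. eapply Rle_trans; [apply Cmod_triangle|].
  rewrite Cmod_conj, !Cmod_mult, Cmod_pow. lra.
Qed.

Lemma Cmod_hterm_diff_le (a b : nat -> C) (z1 z2 : C) (r : R) (n : nat) :
  Cmod z1 <= r -> Cmod z2 <= r ->
  Cmod (RtoC (Cmod z1 ^ 2) * hterm a b z1 n - RtoC (Cmod z2 ^ 2) * hterm a b z2 n)
  <= (Cmod (a n) + Cmod (b n)) * (INR (S n) * r ^ n * Cmod (cubed z1 - cubed z2)).
Proof.
  intros H1 H2. unfold hterm.
  replace (RtoC (Cmod z1 ^ 2) * (a n * z1 ^ S n + Cconj (b n * z1 ^ S n)) -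
           RtoC (Cmod z2 ^ 2) * (a n * z2 ^ S n + Cconj (b n * z2 ^ S n)))%C with
    (a n * (RtoC (Cmod z1 ^ 2) * z1 ^ S n - RtoC (Cmod z2 ^ 2) * z2 ^ S n) +
     Cconj (b n * (RtoC (Cmod z1 ^ 2) * z1 ^ S n - RtoC (Cmod z2 ^ 2) * z2 ^ S n)))%C
    by (rewrite !Cmult_conj, Cminus_conj, !Cmult_conj, !Cconj_R; ring).
  eapply Rle_trans; [apply Cmod_triangle|].
  rewrite Cmod_conj, !(Cmod_mult (a n)), !(Cmod_mult (b n)), Rmult_plus_distr_r.
  pose proof (cubed_power_lipschitz z1 z2 r n H1 H2).
  apply Rplus_le_compat; apply Rmult_le_compat_l; auto using Cmod_ge_0.
Qed.

Lemma linear_part_hterm (a b : nat -> C) (z : C) :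
  (RtoC (Cmod z ^ 2) * hterm a b z 0)%C = linear_part a b (cubed z).
Proof.
  unfold linear_part, hterm, cubed. rewrite Cpow_1_r.
  rewrite !Cmult_conj, Cconj_R. ring.
Qed.

Lemma remainder_approx (g : C -> C) (a b : nat -> C) (z : C) (B q : R) (N : nat) :
  Cmod z < 1 -> Cmod (g z - sum_n (hterm a b z) N) <= B * q ^ N ->
  Cmod (remainder g a b z - RtoC (Cmod z ^ 2) * (sum_n (hterm a b z) N - hterm a b z 0)) <= B * q ^ N.
Proof.
  intros Hz H. unfold remainder, F. rewrite <- linear_part_hterm.
  replace (RtoC (Cmod z ^ 2) * g z - RtoC (Cmod z ^ 2) * hterm a b z 0 -
     RtoC (Cmod z ^ 2) * (sum_n (hterm a b z) N - hterm a b z 0))%C with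
    (RtoC (Cmod z ^ 2) * (g z - sum_n (hterm a b z) N))%C by ring.
  rewrite Cmod_mult, Cmod_R, Rabs_pos_eq by apply pow2_ge_0.
  pose proof (Cmod_ge_0 z). pose proof (Cmod_ge_0 (g z - sum_n (hterm a b z) N)).
  assert (Cmod z ^ 2 <= 1) by (simpl; nra). nra.
Qed.

Lemma remainder_lipschitz (g : C -> C) (a b : nat -> C) (k r : R) (z1 z2 : C) :
  series_on_disk g a b -> 0 <= k -> (forall m, (0 < m)%nat -> Cmod (a m) + Cmod (b m) <= k) ->
  0 < r < 1 -> Cmod z1 <= r -> Cmod z2 <= r ->
  Cmod (remainder g a b z1 - remainder g a b z2)
  <= k * ((2 * r - r ^ 2) / (1 - r) ^ 2) * Cmod (cubed z1 - cubed z2).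
Proof.
  intros Hs Hk Hab Hr H1 H2. destruct (Hs r ltac:(lra)) as (B & q & Hq & H).
  set (J := Cmod (cubed z1 - cubed z2)).
  assert (J0 : 0 <= J) by apply Cmod_ge_0.
  pose (T := fun (z : C) N => (RtoC (Cmod z ^ 2) * (sum_n (hterm a b z) N - hterm a b z 0))%C).
  assert (HT : forall N, Cmod (T z1 N - T z2 N) <=
    k * ((1 - INR (N + 2) * r ^ (N + 1) + INR (N + 1) * r ^ (N + 2)) / (1 - r) ^ 2 - 1) * J).
  (* The fraction is the closed form of [sum_(n <= N) (n + 1) r^n]; its term
     [n = 0] belongs to the linear part. *)
  { intro N. induction N as [|N IH].
    - unfold T. rewrite !csum_O.
      replace (RtoC (Cmod z1 ^ 2) * (hterm a b z1 0 - hterm a b z1 0) -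
        RtoC (Cmod z2 ^ 2) * (hterm a b z2 0 - hterm a b z2 0))%C with (RtoC 0) by ring.
      rewrite Cmod_0. right. simpl. field. lra.
    - replace (T z1 (S N) - T z2 (S N))%C with ((T z1 N - T z2 N) +
        (RtoC (Cmod z1 ^ 2) * hterm a b z1 (S N) - RtoC (Cmod z2 ^ 2) * hterm a b z2 (S N)))%C
        by (unfold T; rewrite !csum_S; ring).
      eapply Rle_trans; [apply Cmod_triangle|].
      pose proof (Cmod_hterm_diff_le a b z1 z2 r (S N) H1 H2) as D. fold J in D.
      assert (D0 : 0 <= INR (S (S N)) * r ^ S N * J).
      { apply Rmult_le_pos; auto. apply Rmult_le_pos; [apply pos_INR | apply pow_le; lra]. }
      assert (D1 : (Cmod (a (S N)) + Cmod (b (S N))) * (INR (S (S N)) * r ^ S N * J)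
        <= k * (INR (S (S N)) * r ^ S N * J))
        by (apply Rmult_le_compat_r; [auto|apply Hab; lia]).
      eapply Rle_trans; [apply Rplus_le_compat; [exact IH|eapply Rle_trans; [exact D|exact D1]]|].
      right. rewrite !plus_INR, !S_INR, !pow_add. simpl. field. lra. }
  enough (Cmod (remainder g a b z1 - remainder g a b z2) -
    k * ((2 * r - r ^ 2) / (1 - r) ^ 2) * J <= 0) by lra.
  apply (le_of_geometric _ (2 * B) q Hq). intro N.
  pose proof (remainder_approx g a b z1 B q N ltac:(lra) (H z1 N H1)) as A1.
  pose proof (remainder_approx g a b z2 B q N ltac:(lra) (H z2 N H2)) as A2.
  fold (T z1 N) in A1. fold (T z2 N) in A2.
  assert (Tr : Cmod (remainder g a b z1 - remainder g a b z2) <=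
    Cmod (remainder g a b z1 - T z1 N) + Cmod (T z1 N - T z2 N) + Cmod (remainder g a b z2 - T z2 N)).
  { replace (remainder g a b z1 - remainder g a b z2)%C with
      ((remainder g a b z1 - T z1 N) + (T z1 N - T z2 N) + - (remainder g a b z2 - T z2 N))%C by ring.
    eapply Rle_trans; [apply Cmod_triangle|]. rewrite Cmod_opp.
    apply Rplus_le_compat_r, Cmod_triangle. }
  enough (k * ((1 - INR (N + 2) * r ^ (N + 1) + INR (N + 1) * r ^ (N + 2)) / (1 - r) ^ 2 - 1) * J
    <= k * ((2 * r - r ^ 2) / (1 - r) ^ 2) * J) by (specialize (HT N); lra).
  apply Rmult_le_compat_r; auto. apply Rmult_le_compat_l; auto.
  replace ((2 * r - r ^ 2) / (1 - r) ^ 2) with (1 / (1 - r) ^ 2 - 1) by (field; lra).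
  apply Rplus_le_compat_r, Rmult_le_compat_r.
  - left. apply Rinv_0_lt_compat, pow_lt; lra.
  - replace (N + 2)%nat with (S (N + 1)) by lia. rewrite S_INR. simpl (r ^ S _).
    pose proof (pos_INR (N + 1)). assert (0 <= r ^ (N + 1)) by (apply pow_le; lra).
    assert (0 <= INR (N + 1) * r ^ (N + 1)) by now apply Rmult_le_pos. nra.
Qed.

Lemma remainder_bound (g : C -> C) (a b : nat -> C) (k r : R) (z : C) :
  series_on_disk g a b -> 0 <= k -> (forall m, (0 < m)%nat -> Cmod (a m) + Cmod (b m) <= k) ->
  0 < r < 1 -> Cmod z <= r -> Cmod (remainder g a b z) <= k * (r ^ 4 / (1 - r)).
Proof.
  intros Hs Hk Hab Hr Hz. destruct (Hs r ltac:(lra)) as (B & q & Hq & H).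
  pose proof (Cmod_ge_0 z) as Z0.
  assert (HT : forall N, Cmod (sum_n (hterm a b z) N - hterm a b z 0) <=
    k * ((r ^ 2 - r ^ (N + 2)) / (1 - r))).
  { intro N. induction N as [|N IH].
    - rewrite csum_O. replace (hterm a b z 0 - hterm a b z 0)%C with (RtoC 0) by ring.
      rewrite Cmod_0. right. simpl. field. lra.
    - rewrite csum_S.
      replace (sum_n (hterm a b z) N + hterm a b z (S N) - hterm a b z 0)%C with
        ((sum_n (hterm a b z) N - hterm a b z 0) + hterm a b z (S N))%C by ring.
      eapply Rle_trans; [apply Cmod_triangle|].
      assert (D : Cmod (hterm a b z (S N)) <= k * r ^ (S N + 1)).
      { eapply Rle_trans; [apply Cmod_hterm_le|]. rewrite Nat.add_1_r.
        apply Rmult_le_compat.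
        - generalize (Cmod_ge_0 (a (S N))) (Cmod_ge_0 (b (S N))); lra.
        - now apply pow_le.
        - apply Hab; lia.
        - apply pow_incr; lra. }
      eapply Rle_trans; [apply Rplus_le_compat; [exact IH|exact D]|].
      right. rewrite !pow_add. simpl. field. lra. }
  enough (Cmod (remainder g a b z) - k * (r ^ 4 / (1 - r)) <= 0) by lra.
  apply (le_of_geometric _ B q Hq). intro N.
  pose proof (remainder_approx g a b z B q N ltac:(lra) (H z N Hz)) as A1.
  specialize (HT N).
  set (T := (sum_n (hterm a b z) N - hterm a b z 0)%C) in *.
  assert (Tr : Cmod (remainder g a b z) <=
    Cmod (remainder g a b z - RtoC (Cmod z ^ 2) * T) + Cmod (RtoC (Cmod z ^ 2) * T)).
  { replace (remainder g a b z) with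
      ((remainder g a b z - RtoC (Cmod z ^ 2) * T) + RtoC (Cmod z ^ 2) * T)%C at 1 by ring.
    apply Cmod_triangle. }
  rewrite (Cmod_mult (RtoC _) T), Cmod_R, Rabs_pos_eq in Tr by apply pow2_ge_0.
  assert (R2 : 0 < / (1 - r)) by (apply Rinv_0_lt_compat; lra).
  assert (HT' : Cmod T <= k * (r ^ 2 / (1 - r))).
  { eapply Rle_trans; [exact HT|]. apply Rmult_le_compat_l; auto.
    apply Rmult_le_compat_r; [lra|]. assert (0 <= r ^ (N + 2)) by (apply pow_le; lra). lra. }
  assert (Cmod z ^ 2 * Cmod T <= r ^ 2 * (k * (r ^ 2 / (1 - r)))).
  { apply Rmult_le_compat; auto using Cmod_ge_0, pow2_ge_0. apply pow_incr; lra. }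
  replace (k * (r ^ 4 / (1 - r))) with (r ^ 2 * (k * (r ^ 2 / (1 - r)))) by (field; lra). lra.
Qed.

(** The determinant of the linear part is the Jacobian 1, so its adjugate
    inverts it. *)
Lemma linear_part_inverse (a b : nat -> C) (y : C) :
  Cmod (a 0%nat) ^ 2 - Cmod (b 0%nat) ^ 2 = 1 ->
  linear_part a b (Cconj (a 0%nat) * y - Cconj (b 0%nat) * Cconj y)%C = y.
Proof.
  intro J. unfold linear_part. rewrite Cmult_conj, Cminus_conj, !Cmult_conj, !Cconj_conj.
  transitivity ((a 0%nat * Cconj (a 0%nat) - b 0%nat * Cconj (b 0%nat)) * y)%C; [ring|].
  rewrite <- !Cmod2_conj, <- RtoC_minus, J. ring.
Qed.

Lemma linear_part_lower_bound (a b : nat -> C) (z : C) :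
  Cmod (a 0%nat) ^ 2 - Cmod (b 0%nat) ^ 2 = 1 ->
  Cmod z <= (Cmod (a 0%nat) + Cmod (b 0%nat)) * Cmod (linear_part a b z).
Proof.
  intro J.
  replace z with (Cconj (a 0%nat) * linear_part a b z - Cconj (b 0%nat) * Cconj (linear_part a b z))%C at 1.
  - eapply Rle_trans; [apply Cmod_triangle|].
    rewrite Cmod_opp, !Cmod_mult, !Cmod_conj. lra.
  - unfold linear_part. rewrite Cplus_conj, !Cmult_conj, !Cconj_conj.
    transitivity ((a 0%nat * Cconj (a 0%nat) - b 0%nat * Cconj (b 0%nat)) * z)%C; [ring|].
    rewrite <- !Cmod2_conj, <- RtoC_minus, J. ring.
Qed.

(** * A fixed point in a closed ball *)

Lemma contraction_fixpoint (T : C -> C) (R0 k : R) :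
  0 <= R0 -> 0 <= k < 1 -> (forall x, Cmod x <= R0 -> Cmod (T x) <= R0) ->
  (forall x y, Cmod x <= R0 -> Cmod y <= R0 -> Cmod (T x - T y) <= k * Cmod (x - y)) ->
  exists x, Cmod x <= R0 /\ T x = x.
Proof.
  intros HR Hk Hself Hlip.
  pose (x := fix x (n : nat) : C := match n with O => RtoC 0 | S n => T (x n) end).
  assert (Hx : forall n, Cmod (x n) <= R0).
  { induction n; simpl; [rewrite Cmod_0; auto|auto]. }
  set (c := Cmod (x 1%nat - x 0%nat)).
  assert (Hstep : forall n, Cmod (x (S n) - x n) <= c * k ^ n).
  { induction n as [|n IH]; [unfold c; simpl (k ^ 0); lra|].
    change (x (S (S n))) with (T (x (S n))). change (x (S n)) with (T (x n)) at 2.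
    eapply Rle_trans; [apply Hlip; apply Hx|]. simpl (k ^ S n).
    apply (Rmult_le_compat_l k) in IH; lra. }
  set (D := c / (1 - k)).
  assert (Ed : D * (1 - k) = c) by (unfold D; field; lra).
  assert (D0 : 0 <= D) by (apply Rle_mult_inv_pos; [apply Cmod_ge_0|lra]).
  assert (Hfar : forall n p, Cmod (x (n + p)%nat - x n) <= D * (k ^ n - k ^ (n + p))).
  { intros n p. induction p as [|p IH].
    - rewrite Nat.add_0_r. replace (x n - x n)%C with (RtoC 0) by ring. rewrite Cmod_0. lra.
    - rewrite Nat.add_succ_r.
      replace (x (S (n + p)) - x n)%C with ((x (S (n + p)) - x (n + p)%nat) + (x (n + p)%nat - x n))%C by ring.
      eapply Rle_trans; [apply Cmod_triangle|]. specialize (Hstep (n + p)%nat).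
      simpl (k ^ S _). rewrite <- Ed in Hstep. lra. }
  assert (Hfar' : forall n p, Cmod (x (n + p)%nat - x n) <= D * k ^ n).
  { intros n p. eapply Rle_trans; [apply Hfar|].
    apply Rmult_le_compat_l; auto. assert (0 <= k ^ (n + p)) by (apply pow_le; lra). lra. }
  assert (Lim : forall h : C -> R, (forall u v, Rabs (h u - h v) <= Cmod (u - v)) ->
    exists l : R, forall n, Rabs (h (x n) - l) <= D * k ^ n).
  { intros h Hh.
    assert (Cau : ex_finite_lim_seq (fun n => h (x n))).
    { apply ex_lim_seq_cauchy_corr. intro eps.
      assert (G : is_lim_seq (fun n => D * k ^ n) 0).
      { replace (Finite 0) with (Rbar_mult (Finite D) (Finite 0)) by (simpl; f_equal; ring).
        apply is_lim_seq_scal_l, is_lim_seq_geom. rewrite Rabs_pos_eq; lra. }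
      apply is_lim_seq_spec in G. destruct (G (pos_div_2 eps)) as [N HN].
      exists N. intros n m Hn Hm.
      assert (W : forall n, (N <= n)%nat -> Rabs (h (x n) - h (x N)) < eps / 2).
      { intros j Hj. eapply Rle_lt_trans; [apply Hh|].
        replace j with (N + (j - N))%nat by lia. eapply Rle_lt_trans; [apply Hfar'|].
        specialize (HN N (le_n N)). simpl in HN. rewrite Rminus_0_r in HN.
        eapply Rle_lt_trans; [apply Rle_abs|exact HN]. }
      replace (h (x n) - h (x m)) with ((h (x n) - h (x N)) - (h (x m) - h (x N))) by ring.
      eapply Rle_lt_trans; [apply Rabs_triang|]. rewrite Rabs_Ropp.
      generalize (W n Hn) (W m Hm); lra. }
    destruct Cau as [l Hl]. exists l. intro n.
    apply (is_lim_seq_incr_n _ n) in Hl.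
    apply (is_lim_seq_le (fun p => Rabs (h (x n) - h (x (p + n)%nat))) (fun _ => D * k ^ n)
      (Rabs (h (x n) - l)) (D * k ^ n)).
    - intro p. rewrite Rabs_minus_sym. eapply Rle_trans; [apply Hh|].
      rewrite Nat.add_comm. apply Hfar'.
    - apply (is_lim_seq_abs _ (h (x n) - l)).
      apply is_lim_seq_minus'; [apply is_lim_seq_const|exact Hl].
    - apply is_lim_seq_const. }
  destruct (Lim Re) as [l1 L1].
  { intros u v. exact (re_le_Cmod (u - v)%C). }
  destruct (Lim Im) as [l2 L2].
  { intros u v. exact (Rle_trans _ _ _ (Rmax_r _ _) (Rmax_Cmod (u - v)%C)). }
  set (l := (l1, l2) : C).
  assert (Hl : forall n, Cmod (x n - l) <= 2 * D * k ^ n).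
  { intro n. specialize (L1 n). specialize (L2 n). unfold l.
    destruct (x n) as [u v]. unfold Re, Im in *; simpl fst in *; simpl snd in *.
    unfold Cminus, Cplus, Copp; simpl.
    assert (P : 0 <= D * k ^ n) by (apply Rmult_le_pos; [auto|apply pow_le; lra]).
    apply Cmod_pair_le; [lra|].
    apply pow_maj_Rabs with (n := 2%nat) in L1. apply pow_maj_Rabs with (n := 2%nat) in L2.
    unfold Rminus in L1, L2. replace ((2 * D * k ^ n) ^ 2) with (4 * (D * k ^ n) ^ 2) by ring.
    pose proof (pow2_ge_0 (D * k ^ n)). lra. }
  assert (Hlb : Cmod l <= R0).
  { enough (Cmod l - R0 <= 0) by lra. apply (le_of_geometric _ (2 * D) k Hk). intro n.
    assert (Cmod l <= Cmod (x n) + Cmod (x n - l)).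
    { replace l with (x n + - (x n - l))%C at 1 by ring.
      eapply Rle_trans; [apply Cmod_triangle|]. rewrite Cmod_opp. lra. }
    specialize (Hx n). specialize (Hl n). lra. }
  exists l. split; auto.
  apply (eq_of_geometric _ _ (4 * D) k Hk). intro n.
  replace (T l - l)%C with (- (T (x n) - T l) + (x (S n) - l))%C by (simpl; ring).
  eapply Rle_trans; [apply Cmod_triangle|]. rewrite Cmod_opp.
  assert (T1 : Cmod (T (x n) - T l) <= k * Cmod (x n - l)) by (apply Hlip; auto).
  pose proof (Hl n) as H1. pose proof (Hl (S n)) as H2. simpl (k ^ S n) in H2.
  assert (P : 0 <= 2 * D * k ^ n) by (apply Rmult_le_pos; [lra|apply pow_le; lra]).
  assert (k * Cmod (x n - l) <= 1 * (2 * D * k ^ n))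
    by (apply Rmult_le_compat; try lra; apply Cmod_ge_0).
  assert (k * (2 * D * k ^ n) <= 1 * (2 * D * k ^ n)) by (apply Rmult_le_compat_r; lra).
  lra.
Qed.

(** The inverse of [cubed]: if [zeta = cubed z], then [|zeta| = |z|^3], so the
    factor to divide [zeta] by is [|z|^2 = |zeta|^(2/3)]. At 0 the value of
    [Rpower] does not matter, as it is multiplied by 0. *)
Definition uncubed (z : C) : C := (RtoC (Rpower (Cmod z) (- (2 / 3))) * z)%C.

Lemma cubed_uncubed (z : C) : cubed (uncubed z) = z.
Proof.
  destruct (Ceq_dec z 0) as [->|N].
  - unfold uncubed, cubed. ring.
  - assert (P : 0 < Cmod z) by now apply Cmod_gt_0.
    unfold uncubed, cubed. rewrite Cmod_mult, Cmod_R, (Rabs_pos_eq (Rpower _ _))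
      by (left; apply exp_pos).
    set (t := Rpower (Cmod z) (- (2 / 3))).
    rewrite Cmult_assoc, <- RtoC_mult.
    replace ((t * Cmod z) ^ 2 * t) with 1; [ring|].
    replace ((t * Cmod z) ^ 2 * t) with (t ^ 3 * Cmod z ^ 2) by ring.
    unfold t. rewrite <- (Rpower_pow 3 (Rpower _ _)), Rpower_mult by apply exp_pos.
    rewrite <- (Rpower_pow 2 (Cmod z)), <- Rpower_plus by auto.
    replace (- (2 / 3) * INR 3 + INR 2) with 0 by (simpl; field).
    now rewrite Rpower_O.
Qed.

Lemma cube_le (x y : R) : 0 <= y -> x ^ 3 <= y ^ 3 -> x <= y.
Proof. intros Hy H. apply Rnot_lt_le; intro L. assert (y ^ 3 < x ^ 3); [|lra].
  assert (0 < (x - y) * (x ^ 2 + x * y + y ^ 2)); [|lra].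
  apply Rmult_lt_0_compat; [lra|]. nra. Qed.

(** * Univalence and covering for a fixed radius *)

Lemma cubed_injective (z1 z2 : C) : cubed z1 = cubed z2 -> z1 = z2.
Proof.
  assert (W : forall z1 z2, Cmod z2 <= Cmod z1 -> cubed z1 = cubed z2 -> z1 = z2).
  { clear; intros z1 z2 H E. pose proof (cubed_dist_lower_bound z1 z2 H) as X.
    rewrite E in X. replace (cubed z2 - cubed z2)%C with (RtoC 0) in X by ring. rewrite Cmod_0 in X.
    destruct (Ceq_dec z2 0) as [->|N].
    - apply Cmod_eq_0.
      assert (Z : Cmod z1 ^ 3 = 0) by (rewrite <- Cmod_cubed, E, Cmod_cubed, Cmod_0; ring).
      destruct (Req_dec (Cmod z1) 0) as [|Q]; auto. now apply (pow_nonzero _ 3) in Q.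
    - apply Cmod_gt_0 in N. apply Cminus_eq_0, Cmod_eq_0.
      pose proof (Cmod_ge_0 (z1 - z2)). assert (0 < Cmod z2 ^ 2) by now apply pow_lt.
      nra. }
  intro E. destruct (Rle_dec (Cmod z2) (Cmod z1)); [now apply W|].
  symmetry. apply W; [lra|auto].
Qed.

(** With [mu = |a 0| + |b 0|], a bound for the inverse of the linear part, and
    the Lipschitz constant of the remainder as the other factor, this makes
    [zeta |-> L^(-1) (w - R)] a contraction. *)
Lemma contraction_constant (k rho lam mu : R) :
  0 <= k -> 0 < rho < 1 -> 0 < lam -> 0 <= mu -> lam * mu <= 1 ->
  k * (2 * rho - rho ^ 2) < lam * (1 - rho) ^ 2 ->
  0 <= mu * (k * ((2 * rho - rho ^ 2) / (1 - rho) ^ 2)) < 1.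
Proof.
  intros Hk Hr Hl Hmu Hlm H.
  assert (P : 0 < (1 - rho) ^ 2) by (apply pow_lt; lra).
  assert (N : 0 <= 2 * rho - rho ^ 2) by nra.
  set (x := k * ((2 * rho - rho ^ 2) / (1 - rho) ^ 2)).
  assert (X0 : 0 <= x) by (apply Rmult_le_pos; [auto|apply Rle_mult_inv_pos; auto]).
  assert (X1 : x < lam).
  { apply (Rmult_lt_reg_r ((1 - rho) ^ 2)); auto. unfold x, Rdiv.
    rewrite !Rmult_assoc, Rinv_l by lra. lra. }
  split; [now apply Rmult_le_pos|].
  destruct (Req_dec mu 0) as [->|]; [lra|].
  assert (mu * x < mu * lam) by (apply Rmult_lt_compat_l; lra). lra.
Qed.

(** If [F g z1 = F g z2], the linear part and the remainder change by opposite
    amounts, which the contraction constant forbids unless both are 0. *)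
Lemma univalent_on_radius (g : C -> C) (a b : nat -> C) (lam k rho : R) (z1 z2 : C) :
  series_on_disk g a b -> 0 <= k -> (forall m, (0 < m)%nat -> Cmod (a m) + Cmod (b m) <= k) ->
  Cmod (a 0%nat) ^ 2 - Cmod (b 0%nat) ^ 2 = 1 ->
  0 < lam -> lam * (Cmod (a 0%nat) + Cmod (b 0%nat)) <= 1 ->
  0 < rho < 1 -> k * (2 * rho - rho ^ 2) < lam * (1 - rho) ^ 2 ->
  Cmod z1 <= rho -> Cmod z2 <= rho -> F g z1 = F g z2 -> z1 = z2.
Proof.
  intros Hs Hk Hab J Hl Hlm Hr H H1 H2 E.
  apply cubed_injective, Cminus_eq_0, Cmod_eq_0.
  assert (Hmu : 0 <= Cmod (a 0%nat) + Cmod (b 0%nat))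
    by (generalize (Cmod_ge_0 (a 0%nat)) (Cmod_ge_0 (b 0%nat)); lra).
  pose proof (contraction_constant k rho lam _ Hk Hr Hl Hmu Hlm H) as Q.
  pose proof (remainder_lipschitz g a b k rho z1 z2 Hs Hk Hab Hr H1 H2) as L.
  pose proof (linear_part_lower_bound a b (cubed z1 - cubed z2) J) as X.
  assert (E' : Cmod (linear_part a b (cubed z1 - cubed z2)) =
    Cmod (remainder g a b z1 - remainder g a b z2)).
  { rewrite <- Cmod_opp. f_equal. unfold remainder. rewrite E. unfold linear_part.
    rewrite !Cmult_conj, Cminus_conj. ring. }
  rewrite E' in X. pose proof (Cmod_ge_0 (cubed z1 - cubed z2)) as P.
  set (mu := Cmod (a 0%nat) + Cmod (b 0%nat)) in *.
  set (c := k * ((2 * rho - rho ^ 2) / (1 - rho) ^ 2)) in *.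
  apply (Rmult_le_compat_l mu) in L; auto. nra.
Qed.

(** For a target [w], the variable [zeta = cubed z] of a solution [z] is a fixed
    point of [zeta |-> L^(-1) (w - R)], a contraction of the ball of radius
    [rho^3]. *)
Lemma covering_on_radius (g : C -> C) (a b : nat -> C) (lam k rho : R) (w : C) :
  series_on_disk g a b -> 0 <= k -> (forall m, (0 < m)%nat -> Cmod (a m) + Cmod (b m) <= k) ->
  Cmod (a 0%nat) ^ 2 - Cmod (b 0%nat) ^ 2 = 1 ->
  0 < lam -> lam * (Cmod (a 0%nat) + Cmod (b 0%nat)) <= 1 ->
  0 < rho < 1 -> k * (2 * rho - rho ^ 2) < lam * (1 - rho) ^ 2 ->
  Cmod w < lam * rho ^ 3 - k * (rho ^ 4 / (1 - rho)) ->
  exists z, Cmod z < rho /\ F g z = w.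
Proof.
  intros Hs Hk Hab J Hl Hlm Hr H Hw.
  assert (Hmu : 0 <= Cmod (a 0%nat) + Cmod (b 0%nat))
    by (generalize (Cmod_ge_0 (a 0%nat)) (Cmod_ge_0 (b 0%nat)); lra).
  pose proof (contraction_constant k rho lam _ Hk Hr Hl Hmu Hlm H) as Q.
  set (mu := Cmod (a 0%nat) + Cmod (b 0%nat)) in *.
  set (c := k * ((2 * rho - rho ^ 2) / (1 - rho) ^ 2)) in *.
  pose (Linv := fun y => (Cconj (a 0%nat) * y - Cconj (b 0%nat) * Cconj y)%C).
  assert (HLinv : forall y, Cmod (Linv y) <= mu * Cmod y).
  { intro y. unfold Linv. eapply Rle_trans; [apply Cmod_triangle|].
    rewrite Cmod_opp, !Cmod_mult, !Cmod_conj. unfold mu; lra. }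
  assert (R3 : 0 < rho ^ 3) by (apply pow_lt; lra).
  assert (Hu : forall x, Cmod x <= rho ^ 3 -> Cmod (uncubed x) <= rho).
  { intros x Hx. apply cube_le; [lra|]. now rewrite <- Cmod_cubed, cubed_uncubed. }
  pose (T := fun x => Linv (w - remainder g a b (uncubed x))%C).
  assert (HT : forall x, Cmod x <= rho ^ 3 -> Cmod (T x) < rho ^ 3).
  { intros x Hx. unfold T. eapply Rle_lt_trans; [apply HLinv|].
    pose proof (remainder_bound g a b k rho _ Hs Hk Hab Hr (Hu x Hx)) as B.
    assert (B' : Cmod (w - remainder g a b (uncubed x)) < lam * rho ^ 3).
    { eapply Rle_lt_trans; [apply Cmod_triangle|]. rewrite Cmod_opp. lra. }
    pose proof (Cmod_ge_0 (w - remainder g a b (uncubed x))) as P.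
    destruct (Req_dec mu 0) as [->|]; [lra|].
    apply (Rmult_lt_compat_l mu) in B'; [|lra].
    assert ((lam * mu) * rho ^ 3 <= 1 * rho ^ 3) by (apply Rmult_le_compat_r; lra). lra. }
  destruct (contraction_fixpoint T (rho ^ 3) (mu * c)) as (x & Hx & E); [lra|exact Q| | |].
  - intros x Hx. left; auto.
  - intros x y Hx Hy. unfold T.
    replace (Linv (w - remainder g a b (uncubed x)) - Linv (w - remainder g a b (uncubed y)))%C with
      (Linv (remainder g a b (uncubed y) - remainder g a b (uncubed x)))%C
      by (unfold Linv; rewrite !Cminus_conj; ring).
    eapply Rle_trans; [apply HLinv|]. rewrite Rmult_assoc. apply Rmult_le_compat_l; auto.
    eapply Rle_trans; [apply (remainder_lipschitz g a b k rho); auto|].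
    rewrite !cubed_uncubed. fold c. right. f_equal. rewrite <- Cmod_opp. f_equal; ring.
  - exists (uncubed x). split.
    + apply Rnot_le_lt; intro L.
      assert (L3 : rho ^ 3 <= Cmod (uncubed x) ^ 3) by (apply pow_incr; lra).
      rewrite <- Cmod_cubed, cubed_uncubed in L3.
      specialize (HT x Hx). rewrite E in HT. lra.
    + transitivity (linear_part a b (cubed (uncubed x)) + remainder g a b (uncubed x))%C.
      * unfold remainder. ring.
      * rewrite cubed_uncubed. rewrite <- E at 1.
        unfold T, Linv. rewrite linear_part_inverse by auto. ring.
Qed.

(** * The constants *)

(** Squaring twice reduces the claim to [(PI^2 - 16)^2 >= 0]. *)
Lemma M0_ge_1 : 1 <= M0.
Proof.
  unfold M0. pose proof PI_RGT_0 as P. pose proof PI2_3_2 as P3.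
  assert (Q : 0 < 2 * PI ^ 2 - 16) by nra.
  assert (S1 : 0 < sqrt (sqrt (2 * PI ^ 2 - 16))) by now apply sqrt_lt_R0, sqrt_lt_R0.
  apply (Rmult_le_reg_r (2 * sqrt (sqrt (2 * PI ^ 2 - 16)))); [lra|].
  unfold Rdiv. rewrite Rmult_assoc, Rinv_l, Rmult_1_l, Rmult_1_r by lra.
  enough (sqrt (sqrt (2 * PI ^ 2 - 16)) <= PI / 2) by lra.
  rewrite <- (sqrt_pow2 (PI / 2)) by lra. apply sqrt_le_1_alt.
  rewrite <- (sqrt_pow2 ((PI / 2) ^ 2)) by apply pow2_ge_0. apply sqrt_le_1_alt.
  enough (0 <= (PI ^ 2 - 16) ^ 2) by lra. apply pow2_ge_0.
Qed.

Lemma lambda0_pos (M : R) : 1 <= M -> 0 < lambda0 M.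
Proof.
  intro H. unfold lambda0. destruct (Rle_dec M M0).
  - apply Rdiv_lt_0_compat; [apply sqrt_lt_R0; lra|].
    assert (0 < sqrt (M ^ 2 + 1)) by (apply sqrt_lt_R0; generalize (pow2_ge_0 M); lra).
    generalize (sqrt_pos (M ^ 2 - 1)); lra.
  - apply Rdiv_lt_0_compat; [apply PI_RGT_0|lra].
Qed.

Lemma sqrt2_mult_le (x y : R) : 0 <= x -> 2 * x ^ 2 <= y -> sqrt 2 * x <= sqrt y.
Proof.
  intros Hx H. rewrite <- (sqrt_pow2 x) at 1 by auto.
  rewrite <- sqrt_mult by (try apply pow2_ge_0; lra). now apply sqrt_le_1_alt.
Qed.

(** Both bounds hold for every [M >= 1]: the first one because
    [2 A^2 <= M^2 + 1] and [2 B^2 <= M^2 - 1], the second by [A + B <= 4 M / PI].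
    The case distinction in [lambda0] selects one of the two. *)
Lemma lambda0_bound (M A B : R) : 1 <= M -> 0 <= A -> 0 <= B -> A ^ 2 - B ^ 2 = 1 ->
  A ^ 2 + B ^ 2 <= M ^ 2 -> A + B <= 4 * M / PI -> lambda0 M * (A + B) <= 1.
Proof.
  intros HM HA HB J H1 H2. unfold lambda0. destruct (Rle_dec M M0).
  - assert (0 < sqrt (M ^ 2 + 1)) by (apply sqrt_lt_R0; generalize (pow2_ge_0 M); lra).
    pose proof (sqrt_pos (M ^ 2 - 1)).
    assert (sqrt 2 * A <= sqrt (M ^ 2 + 1)) by (apply sqrt2_mult_le; lra).
    assert (sqrt 2 * B <= sqrt (M ^ 2 - 1)) by (apply sqrt2_mult_le; lra).
    set (d := sqrt (M ^ 2 - 1) + sqrt (M ^ 2 + 1)).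
    apply (Rmult_le_reg_r d); [unfold d; lra|].
    replace (sqrt 2 / d * (A + B) * d) with (sqrt 2 * A + sqrt 2 * B) by (field; unfold d; lra).
    unfold d; lra.
  - pose proof PI_RGT_0.
    assert (P : 0 < PI / (4 * M)) by (apply Rdiv_lt_0_compat; lra).
    apply (Rmult_le_compat_l (PI / (4 * M))) in H2; [|lra].
    replace (PI / (4 * M) * (4 * M / PI)) with 1 in H2 by (field; lra). exact H2.
Qed.

(** The Jacobian condition forces [A^2 + B^2 >= 1], which leaves at most
    [M^2 - 1] for [x^2 + y^2 >= (x + y)^2 / 2]. *)
Lemma K_bound (M A B x y : R) : A ^ 2 - B ^ 2 = 1 -> (A ^ 2 + B ^ 2) + (x ^ 2 + y ^ 2) <= M ^ 2 ->
  0 <= x + y -> x + y <= 4 * M / PI -> x + y <= K M.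
Proof.
  intros J H P H2. unfold K. apply Rmin_glb; auto.
  rewrite <- (sqrt_pow2 (x + y)) by auto. apply sqrt_le_1_alt.
  generalize (pow2_ge_0 (x - y)) (pow2_ge_0 B); lra.
Qed.

Lemma K_pos (M : R) : 1 < M -> 0 < K M.
Proof.
  intro H. pose proof PI_RGT_0. unfold K. apply Rmin_glb_lt.
  - apply sqrt_lt_R0. nra.
  - apply Rdiv_lt_0_compat; lra.
Qed.

Lemma K_1 : K 1 = 0.
Proof.
  pose proof PI_RGT_0. unfold K. replace (2 * 1 ^ 2 - 2) with 0 by ring. rewrite sqrt_0.
  apply Rmin_left, Rle_mult_inv_pos; lra.
Qed.

Lemma lambda0_1 : lambda0 1 = 1.
Proof.
  unfold lambda0. destruct (Rle_dec 1 M0) as [_|N]; [|destruct (N M0_ge_1)].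
  replace (1 ^ 2 - 1) with 0 by ring. replace (1 ^ 2 + 1) with 2 by ring.
  rewrite sqrt_0, Rplus_0_l. apply Rinv_r. generalize (sqrt_lt_R0 2); lra.
Qed.

Lemma r4_1 : r4 1 = 1.
Proof.
  unfold r4. rewrite K_1, lambda0_1.
  replace (1 * 0 + 4 * 0 ^ 2) with 0 by ring. rewrite sqrt_0. field.
Qed.

Lemma sigma4_1 : sigma4 1 = 1.
Proof. unfold sigma4. destruct (Rlt_dec 1 1); [lra|auto]. Qed.

(** [r4] is the root in (0, 1) of this equation, which says that
    [lambda0 = K * sum_(n >= 2) (n + 2) r^(n-1)]. *)
Lemma r4_equation (M : R) : 1 < M ->
  0 < r4 M < 1 /\ lambda0 M * (1 - r4 M) ^ 2 = K M * (4 * r4 M - 3 * r4 M ^ 2).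
Proof.
  intro HM. pose proof (lambda0_pos M ltac:(lra)) as L. pose proof (K_pos M HM) as P.
  unfold r4. set (l := lambda0 M) in *. set (k := K M) in *. clearbody l k.
  assert (Q : 0 < l * k + 4 * k ^ 2) by nra.
  pose proof (sqrt_lt_R0 _ Q) as S0.
  assert (S2 : sqrt (l * k + 4 * k ^ 2) ^ 2 = l * k + 4 * k ^ 2) by (apply pow2_sqrt; lra).
  set (s := sqrt (l * k + 4 * k ^ 2)) in *. clearbody s.
  assert (D : 0 < l + 2 * k + s) by lra.
  split.
  - split; [now apply Rdiv_lt_0_compat|].
    apply (Rmult_lt_reg_r (l + 2 * k + s)); auto.
    unfold Rdiv. rewrite Rmult_assoc, Rinv_l by lra. lra.
  - apply (Rmult_eq_reg_r ((l + 2 * k + s) ^ 2)); [|apply pow_nonzero; lra].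
    transitivity (l * (2 * k + s) ^ 2); [field; lra|].
    transitivity (k * l * (4 * (l + 2 * k + s) - 3 * l)); [|field; lra].
    replace (l * (2 * k + s) ^ 2) with (l * (4 * k ^ 2 + 4 * k * s + s ^ 2)) by ring.
    rewrite S2. ring.
Qed.

(** For [M > 1] and [r = r4], [K (2 r - r^2) < K (4 r - 3 r^2) = lambda0 (1 - r)^2]; for
    smaller [rho] the left side decreases and the right side increases. *)
Lemma contraction_below_r4 (M rho : R) : 1 <= M -> 0 < rho < 1 -> rho <= r4 M ->
  K M * (2 * rho - rho ^ 2) < lambda0 M * (1 - rho) ^ 2.
Proof.
  intros HM Hr H. destruct (Req_dec M 1) as [->|N].
  - rewrite K_1, lambda0_1. assert (0 < (1 - rho) ^ 2) by (apply pow_lt; lra). lra.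
  - destruct (r4_equation M ltac:(lra)) as [R E].
    pose proof (K_pos M ltac:(lra)) as P. pose proof (lambda0_pos M HM) as L.
    set (r := r4 M) in *. clearbody r.
    apply Rle_lt_trans with (K M * (2 * r - r ^ 2)).
    + apply Rmult_le_compat_l; [lra|]. nra.
    + apply Rlt_le_trans with (lambda0 M * (1 - r) ^ 2).
      * rewrite E. apply Rmult_lt_compat_l; [lra|]. nra.
      * apply Rmult_le_compat_l; [lra|]. apply pow_incr; lra.
Qed.

Lemma r4_range (M : R) : 1 <= M -> 0 < r4 M <= 1.
Proof.
  intro H. destruct (Req_dec M 1) as [->|N]; [rewrite r4_1; lra|].
  destruct (r4_equation M ltac:(lra)); lra.
Qed.

Lemma sigma4_pos (M : R) : 1 <= M -> 0 < sigma4 M.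
Proof.
  intro H. unfold sigma4. destruct (Rlt_dec 1 M) as [L|]; [|lra].
  destruct (r4_equation M L) as [R E]. pose proof (K_pos M L) as P.
  set (r := r4 M) in *. clearbody r.
  assert (Q : 0 < (1 - r) ^ 2) by (apply pow_lt; lra).
  apply (Rmult_lt_reg_r ((1 - r) ^ 2)); auto. rewrite Rmult_0_l.
  replace ((lambda0 M * r ^ 3 - K M * (r ^ 4 / (1 - r))) * (1 - r) ^ 2) with
    (r ^ 3 * (lambda0 M * (1 - r) ^ 2) - K M * r ^ 4 * (1 - r)) by (field; lra).
  rewrite E.
  replace (r ^ 3 * (K M * (4 * r - 3 * r ^ 2)) - K M * r ^ 4 * (1 - r)) with
    (K M * r ^ 4 * (3 - 2 * r)) by ring.
  apply Rmult_lt_0_compat; [apply Rmult_lt_0_compat; [auto|apply pow_lt; lra]|lra].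
Qed.

(** * Admissible functions *)

Lemma admissible_data (M : R) (g : C -> C) : admissible M g ->
  1 <= M /\ exists a b : nat -> C, series_on_disk g a b /\
    Cmod (a 0%nat) ^ 2 - Cmod (b 0%nat) ^ 2 = 1 /\
    lambda0 M * (Cmod (a 0%nat) + Cmod (b 0%nat)) <= 1 /\
    forall m, (0 < m)%nat -> Cmod (a m) + Cmod (b m) <= K M.
Proof.
  intros (Hg & H0 & HJ & HM).
  destruct (bounded_harmonic_series g M Hg H0 HM) as (a & b & A0 & B0 & Hs & Heinz & P0 & Pm).
  assert (J : Cmod (a 0%nat) ^ 2 - Cmod (b 0%nat) ^ 2 = 1).
  { unfold jacobian in HJ. rewrite A0, B0, Cmod_conj. lra. }
  assert (MP : 0 <= M).
  { eapply Rle_trans; [apply (Cmod_ge_0 (g 0))|]. apply HM. unfold disk; rewrite Cmod_0; lra. }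
  assert (M1 : 1 <= M).
  { pose proof (pow2_ge_0 (Cmod (b 0%nat))). apply Rnot_lt_le; intro L. nra. }
  split; auto. exists a, b. split; [exact Hs|]. split; [auto|]. split.
  - apply lambda0_bound; auto using Cmod_ge_0.
  - intros m Hm. apply (K_bound M (Cmod (a 0%nat)) (Cmod (b 0%nat))); auto.
    generalize (Cmod_ge_0 (a m)) (Cmod_ge_0 (b m)); lra.
Qed.

Lemma K_nonneg (M : R) : 1 <= M -> 0 <= K M.
Proof.
  intro H. destruct (Req_dec M 1) as [->|N]; [rewrite K_1; lra|].
  left; apply K_pos; lra.
Qed.

Lemma landau_univalent (M : R) (g : C -> C) :
  admissible M g -> univalent_in (disk 1) (F g) (disk (r4 M)).
Proof.
  intro H. destruct (admissible_data M g H) as (M1 & a & b & Hs & J & Hl & Hk).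
  pose proof (r4_range M M1) as R. split.
  - unfold disk; intros; lra.
  - unfold disk; intros z w Hz Hw E.
    (* The term [r4 M / 2] keeps [rho] positive when [z = w = 0]. *)
    pose (rho := Rmax ((r4 M) / 2) (Rmax (Cmod z) (Cmod w))).
    assert (R1 : rho < r4 M) by (repeat apply Rmax_lub_lt; lra).
    assert (R0 : 0 < rho) by (eapply Rlt_le_trans; [|apply Rmax_l]; lra).
    apply (univalent_on_radius g a b (lambda0 M) (K M) rho); auto.
    + now apply K_nonneg.
    + now apply lambda0_pos.
    + lra.
    + apply contraction_below_r4; lra.
    + eapply Rle_trans; [apply Rmax_l|apply Rmax_r].
    + eapply Rle_trans; [apply Rmax_r|apply Rmax_r].
Qed.

Lemma landau_covering (M : R) (g : C -> C) :
  admissible M g -> image_contains (F g) (disk (r4 M)) (disk (sigma4 M)).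
Proof.
  intros H w Hw. destruct (admissible_data M g H) as (M1 & a & b & Hs & J & Hl & Hk).
  unfold disk in *.
  assert (Ex : exists rho, 0 < rho < 1 /\ rho <= r4 M /\
    Cmod w < lambda0 M * rho ^ 3 - K M * (rho ^ 4 / (1 - rho))).
  { unfold sigma4 in Hw. destruct (Rlt_dec 1 M) as [L|L].
    - exists (r4 M). destruct (r4_equation M L) as [R _]. split; [auto|split; [lra|auto]].
    - assert (M = 1) as -> by lra. rewrite r4_1, lambda0_1, K_1.
      pose proof (Cmod_ge_0 w).
      (* Now [r4 = 1], so a smaller radius is needed. By Bernoulli, this one has
         a cube of at least [1 - 3 (1 - |w|) / 4], hence above [|w|]. *)
      exists (1 - (1 - Cmod w) / 4). split; [lra|split; [lra|]].
      pose proof (pow_lower ((1 - Cmod w) / 4) 3 ltac:(lra)) as B. simpl INR in B. lra. }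
  destruct Ex as (rho & Hr & Hr4 & Hw').
  destruct (covering_on_radius g a b (lambda0 M) (K M) rho w) as (z & Hz & E); auto.
  - now apply K_nonneg.
  - now apply lambda0_pos.
  - now apply contraction_below_r4.
  - exists z. split; [lra|auto].
Qed.

Lemma ex_diff_n_const (c x y : R) (n : nat) : ex_diff_n (fun _ _ => c) n x y.
Proof.
  revert c; induction n as [|n IH]; intro c; simpl; (split; [apply continuity_2d_pt_const|auto]).
  split; [apply ex_derive_const|]. split; [apply ex_derive_const|].
  split; apply (ex_diff_n_ext_loc (fun _ _ => 0)); auto;
    exists (mkposreal 1 Rlt_0_1); intros; symmetry; apply Derive_const.
Qed.

Lemma identity_admissible : admissible 1 (fun z => z).
Proof.
  assert (Dx : forall x y, Derive (fun t => re_part (fun z => z) t y) x = 1)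
    by (intros; apply (Derive_id x)).
  split; [|split; [|split]].
  - assert (Loc : forall (P : R -> R -> Prop) x y, (forall u v, P u v) -> locally_2d P x y)
      by (intros P x y HP; exists (mkposreal 1 Rlt_0_1); auto).
    split; intros x y _; unfold re_part, im_part, Re, Im; simpl fst; simpl snd; split.
    + split; [apply continuity_2d_pt_id1|]. split; [apply ex_derive_id|].
      split; [apply ex_derive_const|].
      split; [apply (ex_diff_n_ext_loc (fun _ _ => 1)) | apply (ex_diff_n_ext_loc (fun _ _ => 0))];
        try apply ex_diff_n_const; apply Loc; intros; symmetry; [apply Derive_id|apply Derive_const].
    + unfold partial_derive; simpl.
      rewrite (Derive_ext _ (fun _ => 1)) by (intro; apply Derive_id). rewrite Derive_const.
      rewrite (Derive_ext _ (fun _ => 0)) by (intro; apply Derive_const). rewrite Derive_const. ring.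
    + split; [apply continuity_2d_pt_id2|]. split; [apply ex_derive_const|].
      split; [apply ex_derive_id|].
      split; [apply (ex_diff_n_ext_loc (fun _ _ => 0)) | apply (ex_diff_n_ext_loc (fun _ _ => 1))];
        try apply ex_diff_n_const; apply Loc; intros; symmetry; [apply Derive_const|apply Derive_id].
    + unfold partial_derive; simpl.
      rewrite (Derive_ext _ (fun _ => 0)) by (intro; apply Derive_const). rewrite Derive_const.
      rewrite (Derive_ext _ (fun _ => 1)) by (intro; apply Derive_id). rewrite Derive_const. ring.
  - reflexivity.
  - assert (X : deriv_x (fun z => z) 0 = (1, 0)).
    { unfold deriv_x, partial_derive, re_part, im_part, Re, Im; simpl.
      f_equal; [apply Derive_id|apply Derive_const]. }
    assert (Y : deriv_y (fun z => z) 0 = (0, 1)).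
    { unfold deriv_y, partial_derive, re_part, im_part, Re, Im; simpl.
      f_equal; [apply Derive_const|apply Derive_id]. }
    unfold jacobian, deriv_z, deriv_zbar. rewrite X, Y, !Cmod2_alt.
    unfold Re, Im, Ci, Cmult, Cplus, Cminus, Copp, RtoC; simpl. field.
  - unfold disk; intros; lra.
Qed.

Theorem corollary2p12 :
  (forall (M : R) (g : C -> C),
     admissible M g ->
     0 < r4 M /\
     univalent_in (disk 1) (F g) (disk (r4 M)) /\
     0 < sigma4 M /\
     image_contains (F g) (disk (r4 M)) (disk (sigma4 M)))
  /\
  (r4 1 = 1 /\ sigma4 1 = 1 /\
   (forall r : R, r4 1 < r ->
      ~ (forall g : C -> C, admissible 1 g ->
           univalent_in (disk 1) (F g) (disk r))) /\
   (forall s : R, sigma4 1 < s ->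
      ~ (forall g : C -> C, admissible 1 g ->
           image_contains (F g) (disk (r4 1)) (disk s)))).
Proof.
  split; [|split; [exact r4_1|split; [exact sigma4_1|split]]].
  - intros M g H. destruct (admissible_data M g H) as (M1 & _).
    split; [now apply r4_range|]. split; [now apply landau_univalent|].
    split; [now apply sigma4_pos|now apply landau_covering].
  - intros r Hr H. rewrite r4_1 in Hr.
    destruct (H _ identity_admissible) as [D _].
    specialize (D 1). unfold disk in D. rewrite Cmod_1 in D. specialize (D Hr). lra.
  - intros s Hs H. rewrite sigma4_1 in Hs.
    destruct (H _ identity_admissible 1) as (z & Hz & E).
    + unfold disk. now rewrite Cmod_1.
    + unfold disk in Hz. rewrite r4_1 in Hz.
      apply (f_equal Cmod) in E. change (F (fun z => z) z) with (cubed z) in E.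
      rewrite Cmod_cubed, Cmod_1 in E. pose proof (Cmod_ge_0 z).
      assert (Cmod z ^ 2 <= 1) by (simpl; nra). simpl in *; nra.
Qed.
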